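(* Let $a>0$ and $0<s<\frac12$. Then the fractional Paley–Wiener space $PW^s_a$ is not a de Branges space; that is, there is no Hermite–Biehler function $E$ such that $PW^s_a=\mathcal H(E)$ as Hilbert spaces (same functions, same norm).
   Context: Fourier transform: $\widehat f(\xi)=\mathcal F f(\xi)=\frac1{\sqrt{2\pi}}\int_{\mathbb R}f(x)e^{-ix\xi}\,dx$ on the Schwartz space $\mathcal S$ of $\mathbb R$. $\mathcal E_a$ is the space of entire functions $f$ such that for every $\varepsilon>0$ there is $C_\varepsilon>0$ with $|f(z)|\le C_\varepsilon e^{(a+\varepsilon)|z|}$ for all $z$. For $f$ entire, $f_0:=f|_{\mathbb R}$. Fractional Laplacian: for $f\in\mathcal S$, $\Delta^{s/2}f=\mathcal F^{-1}(|\cdot|^s\widehat f)$. For $0<s<\frac12$ and $f\in\mathcal S'$, we say $\|\Delta^{s/2}f\|_{L^2}<\infty$ if there is $\{f_n\}\subseteq\mathcal S$ with $f_n\to f$ in $\mathcal S'$ and $\{\Delta^{s/2}f_n\}$ Cauchy in $L^2(\mathbb R)$; then $\Delta^{s/2}f:=\lim_n\Delta^{s/2}f_n$ in $L^2$. Let $\frac12-\frac1{2^*}=s$ and $E^{s,2}=\{f\in L^{2^*}(\mathbb R):\|f\|_{E^{s,2}}:=\|\Delta^{s/2}f\|_{L^2}<\infty\}$. Then $PW^s_a=\{f\in\mathcal E_a:f_0\in E^{s,2}\}$ with norm $\|f\|_{PW^s_a}=\|f_0\|_{E^{s,2}}$. De Branges spaces: a Hermite–Biehler function is an entire function $E$ with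 $|E(z)|>|E(\bar z)|$ for $\operatorname{Im}z>0$. The de Branges space $\mathcal H(E)$ is the Hilbert space of entire functions $f$ such that $f/E$ and $f^\#/E$ belong to the Hardy space $H^2(\mathbb C_+)$ of the upper half-plane, where $f^\#(z)=\overline{f(\bar z)}$, with norm $\|f\|^2_{\mathcal H(E)}=\int_{\mathbb R}|f(x)/E(x)|^2\,dx$. *)

(* Defs.v *)
From HB Require Import structures.
From mathcomp Require Import all_boot all_order all_algebra.
From mathcomp Require Import all_classical all_reals all_analysis.
From mathcomp Require Import complex.

Set Implicit Arguments.
Unset Strict Implicit.
Unset Printing Implicit Defensive.

Import Order.TTheory GRing.Theory Num.Theory.
Import numFieldNormedType.Exports.

Local Open Scope classical_set_scope.
Local Open Scope ring_scope.
Local Open Scope complex_scope.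

(* [R[i]] seen as a [numClosedFieldType]: this is what gives it the topology of
   its modulus and the structure of a normed module over itself, so that
   [derivable f z 1] is complex differentiability at [z]. *)
Definition Cx (R : realType) : numClosedFieldType := R[i].

(* The modulus as an element of [R]; the norm [`|z|] of [Cx R] is the same
   number, embedded in [Cx R]. *)
Definition cabs (R : realType) (z : Cx R) : R := ComplexField.Normc.normc z.

Definition expi (R : realType) (t : R) : Cx R := cos t +i* sin t.

Definition cintegral (R : realType) (f : R -> Cx R) : Cx R :=
  Rintegral lebesgue_measure setT (fun x => complex.Re (f x)) +i*
  Rintegral lebesgue_measure setT (fun x => complex.Im (f x)).

Definition cmeasurable (R : realType) (f : R -> Cx R) : Prop :=
  measurable_fun setT (fun x => complex.Re (f x)) /\
  measurable_fun setT (fun x => complex.Im (f x)).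

Definition cLnorm (R : realType) (p : R) (f : R -> Cx R) : \bar R :=
  Lnorm lebesgue_measure p%:E (fun x => (cabs (f x))%:E).

Definition in_Lp (R : realType) (p : R) (f : R -> Cx R) : Prop :=
  cmeasurable f /\ (cLnorm p f < +oo)%E.

Definition L2_cauchy (R : realType) (F : nat -> R -> Cx R) : Prop :=
  forall e : R, 0 < e -> exists N : nat, forall m n : nat,
    (N <= m)%N -> (N <= n)%N -> (cLnorm 2 (fun x => F m x - F n x)%R < e%:E)%E.

Definition L2_cvg (R : realType) (F : nat -> R -> Cx R) (g : R -> Cx R) :
    Prop :=
  in_Lp 2 g /\ (fun n => cLnorm 2 (fun x => F n x - g x)) @ \oo --> (0 : \bar R)%E.

(* A complex-valued function is smooth (resp. has rapidly decreasing
   derivatives) iff its real and imaginary parts are. *)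
Definition real_schwartz (R : realType) (u : R -> R) : Prop :=
  forall n : nat,
    (forall x : R, derivable (derive1n n u) x 1) /\
    (forall k : nat, exists M : R, forall x : R,
       `|x| ^+ k * `|derive1n n u x| <= M).

Definition schwartz (R : realType) (f : R -> Cx R) : Prop :=
  real_schwartz (fun x => complex.Re (f x)) /\
  real_schwartz (fun x => complex.Im (f x)).

Definition fourier (R : realType) (f : R -> Cx R) (xi : R) : Cx R :=
  ((Num.sqrt (2 * pi))^-1)%:C * cintegral (fun x => f x * expi (- (x * xi))).

Definition inv_fourier (R : realType) (g : R -> Cx R) (x : R) : Cx R :=
  ((Num.sqrt (2 * pi))^-1)%:C * cintegral (fun xi => g xi * expi (x * xi)).

Definition fracLap_schwartz (R : realType) (s : R) (f : R -> Cx R) :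
    R -> Cx R :=
  inv_fourier (fun xi => (`|xi| `^ s)%:C * fourier f xi).

(* The regular distribution of a locally integrable function of polynomial
   growth in the mean, in particular of a Schwartz or an L^p function. *)
Definition distr_of (R : realType) (f phi : R -> Cx R) : Cx R :=
  cintegral (fun x => f x * phi x).

(* Convergence in S' is convergence against every Schwartz function. The limit
   [T] is not separately required to be linear and continuous on S: that is
   automatic for a limit of such functionals (Banach-Steinhaus). *)
Definition cvg_tempered (R : realType) (fn : nat -> R -> Cx R)
    (T : (R -> Cx R) -> Cx R) : Prop :=
  forall phi : R -> Cx R, schwartz phi ->
    (fun n => distr_of (fn n) phi) @ \oo --> T phi.

Definition fracLap_approx (R : realType) (s : R) (T : (R -> Cx R) -> Cx R)
    (fn : nat -> R -> Cx R) : Prop :=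
  [/\ forall n, schwartz (fn n), cvg_tempered fn T &
      L2_cauchy (fun n => fracLap_schwartz s (fn n))].

Definition fracLap_finite (R : realType) (s : R) (T : (R -> Cx R) -> Cx R) :
    Prop :=
  exists fn : nat -> R -> Cx R, fracLap_approx s T fn.

(* For 0 < s < 1/2 the limit depends on the approximating sequence only up to
   equality almost everywhere; [fracLap] picks a representative. *)
Definition is_fracLap (R : realType) (s : R) (T : (R -> Cx R) -> Cx R)
    (g : R -> Cx R) : Prop :=
  exists fn : nat -> R -> Cx R, fracLap_approx s T fn /\
    L2_cvg (fun n => fracLap_schwartz s (fn n)) g.

Definition fracLap (R : realType) (s : R) (T : (R -> Cx R) -> Cx R) :
    R -> Cx R :=
  xget (fun=> 0) [set g | is_fracLap s T g].

(* The exponent 2^* given by 1/2 - 1/2^* = s. *)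
Definition star_exp (R : realType) (s : R) : R := (2^-1 - s)^-1.

Definition in_Es2 (R : realType) (s : R) (f : R -> Cx R) : Prop :=
  in_Lp (star_exp s) f /\ fracLap_finite s (distr_of f).

Definition Es2_norm (R : realType) (s : R) (f : R -> Cx R) : \bar R :=
  cLnorm 2 (fracLap s (distr_of f)).

Definition entire (R : realType) (f : Cx R -> Cx R) : Prop :=
  forall z : Cx R, derivable f z 1.

Definition on_real (R : realType) (f : Cx R -> Cx R) : R -> Cx R :=
  fun x => f x%:C.

Definition exp_type (R : realType) (a : R) (f : Cx R -> Cx R) : Prop :=
  entire f /\
  forall e : R, 0 < e -> exists C : R, 0 < C /\
    forall z : Cx R, cabs (f z) <= C * expR ((a + e) * cabs z).

Definition PW (R : realType) (s a : R) (f : Cx R -> Cx R) : Prop :=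
  exp_type a f /\ in_Es2 s (on_real f).

Definition PW_norm (R : realType) (s : R) (f : Cx R -> Cx R) : \bar R :=
  Es2_norm s (on_real f).

Definition hermite_biehler (R : realType) (E : Cx R -> Cx R) : Prop :=
  entire E /\
  forall z : Cx R, 0 < complex.Im z -> cabs (E (z^*)%C) < cabs (E z).

(* The Hardy space H^2 of the upper half-plane; the values of [F] outside the
   open upper half-plane are irrelevant. *)
Definition hardy2 (R : realType) (F : Cx R -> Cx R) : Prop :=
  (forall z : Cx R, 0 < complex.Im z -> derivable F z 1) /\
  exists M : R, forall y : R, 0 < y ->
    (\int[lebesgue_measure]_x ((cabs (F (x +i* y)%C)) ^+ 2)%:E <= M%:E)%E.

Definition sharp (R : realType) (f : Cx R -> Cx R) : Cx R -> Cx R :=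
  fun z => ((f (z^*)%C)^*)%C.

Definition deBranges (R : realType) (E f : Cx R -> Cx R) : Prop :=
  [/\ entire f, hardy2 (fun z => f z / E z) &
      hardy2 (fun z => sharp f z / E z)].

(* Real zeros of [E] form a null set, so the convention 1/0 = 0 is harmless. *)
Definition deBranges_norm (R : realType) (E f : Cx R -> Cx R) : \bar R :=
  cLnorm 2 (fun x => on_real f x / on_real E x).

(* Main.v *)
(* The norm of H(E) depends on a function only through its modulus on the real
   line, so f and e^(itz) f have the same norm there. In PW^s_a the squared norm
   is the integral of |xi|^(2s) |fhat(xi)|^2, and multiplication by e^(itz)
   translates fhat by t: moving a bump from ]0, a/4[ to ]a/2, 3a/4[ strictly
   increases it.

   The norm formula needs that the limit defining the fractional Laplacian does
   not depend on the approximating sequence: if k_n -> 0 in S' and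
   h_n = |xi|^s khat_n is Cauchy in L^2, then h_n -> 0 in L^2. Since h_n - h_m is
   small and h_m tends weakly to 0, pairing khat_n - khat_m with a smooth
   multiple of khat_n bounds the norm of h_n. Passing between h_n and the
   fractional Laplacians is Plancherel's identity, obtained by inserting the
   weight e^(-e|x|), whose cosine transform is the Poisson kernel.

   Fourier transforms are split into real cosine and sine transforms, so that
   all integrals are integrals of real functions. *)

Require Import Defs.
From HB Require Import structures.
From mathcomp Require Import all_boot all_order all_algebra.
From mathcomp Require Import all_classical all_reals all_analysis.
From mathcomp Require Import measurable_realfun.
From mathcomp Require Import complex ring lra.

Set Implicit Arguments.
Unset Strict Implicit.
Unset Printing Implicit Defensive.

Import Order.TTheory GRing.Theory Num.Theory.
Import numFieldNormedType.Exports.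
Local Open Scope classical_set_scope.
Local Open Scope ring_scope.

(** Both bumps sit on the positive half-line, because only there is |xi|^(2s) monotone: a
    translation inside the band [-a, a] could otherwise leave the norm unchanged. [fracLap] is a
    choice made by [xget], so no norm can be computed before all admissible limits are known to
    agree. The weight |xi|^(2s) is in general not smooth at 0, hence |xi|^(2s) khat_n need not be a
    test function; this is what forces a smooth multiplier below the weight. Plancherel's identity
    cannot come from Fubini directly, since the kernel cos(x xi) is not integrable in x. The
    exponential weight restores absolute convergence. As it increases to 1, the transform side
    converges monotonically, while the Poisson kernel, positive and of fixed mass, is an approximate
    identity on the other side. Fourier inversion is only established almost everywhere, as a
    consequence of Plancherel; this suffices, since it is applied under an integral. *)

Lemma norm_cos_le1 (R : realType) (x : R) : `|cos x| <= 1.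
Proof. by rewrite ler_norml cos_geN1 cos_le1. Qed.

Lemma norm_sin_le1 (R : realType) (x : R) : `|sin x| <= 1.
Proof. by rewrite ler_norml sin_geN1 sin_le1. Qed.

Local Notation mu := (@lebesgue_measure _).
Local Notation L1 u := (mu.-integrable setT (EFin \o u)).
Local Notation "'\I' u" := (Rintegral mu setT u) (at level 10, u at level 9).
Local Notation S := (@real_schwartz _).
Local Notation Re := (@complex.Re _).
Local Notation Im := (@complex.Im _).
Local Notation cc := (@continuous_cos _).
Local Notation cs := (@continuous_sin _).
Local Notation c1 := (@norm_cos_le1 _).
Local Notation s1 := (@norm_sin_le1 _).

(** * Lebesgue integrals on the real line *)

Section affine.
Variable R : realType.

Definition affine_map (a b : R) : measurableTypeR R -> measurableTypeR R :=
  fun x => a * x + b.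

Lemma measurable_affine_map (a b : R) : measurable_fun [set: measurableTypeR R] (affine_map a b).
Proof. by apply: continuous_measurable_fun => x; apply: cvgD; [apply: cvgM; [exact: cvg_cst|exact: cvg_id]|exact: cvg_cst]. Qed.

(** By uniqueness of Lebesgue measure: the pushforward under the affine map, scaled by [a], gives
    every interval []c, d]] its length. *)
Lemma lebesgue_measure_affine_gt0 (a b : R) (A : set R) : 0 < a -> measurable A ->
  (a%:E * mu (affine_map a b @^-1` A))%E = mu A.
Proof.
move=> a0 mA.
have mf := @measurable_affine_map a b.
pose m1 : {measure set (measurableTypeR R) -> \bar R} :=
  measure_function_pushforward__canonical__measure_function_Measure mu mf.
have a0' : 0 <= a by exact: ltW.
transitivity (mscale (NngNum a0') m1 A); first by [].
apply/esym/lebesgue_measure_unique => // _ [[c d]] _ <-.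
rewrite /mscale /= /m1 /pushforward.
transitivity (a%:E * mu (affine_map a b @^-1` `]c, d]))%E; last by [].
have -> : affine_map a b @^-1` `]c, d]%classic = `](c - b) / a, (d - b) / a]%classic.
  apply/seteqP; split => x /=; rewrite /affine_map !in_itv /=.
  - by rewrite ltr_pdivrMr// ler_pdivlMr// ltrBlDr lerBrDr ![_ * a]mulrC.
  - by rewrite ltr_pdivrMr// ler_pdivlMr// ltrBlDr lerBrDr ![_ * a]mulrC.
rewrite !lebesgue_measure_itv/= !lte_fin ltr_pM2r ?invr_gt0// ltrD2r.
case: ifPn => _; last by rewrite mule0.
rewrite -!EFinB -EFinM; congr EFin; field; exact: lt0r_neq0.
Qed.

Lemma lebesgue_measure_affine (a b : R) (A : set R) : a != 0 -> measurable A ->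
  (`|a|%:E * mu (affine_map a b @^-1` A))%E = mu A.
Proof.
(* A negative slope would turn []c, d]] into [[c', d'[], so this case goes through the reflection
   invariance of the measure instead. *)
move=> a0 mA; have [agt0|ale0] := ltP 0 a.
  by rewrite gtr0_norm// lebesgue_measure_affine_gt0.
have alt0 : a < 0 by rewrite lt_neqAle a0.
rewrite ltr0_norm// -[RHS](@lebesgue_measure_affine_gt0 (- a) b) ?oppr_gt0//.
congr (_ * _)%E.
have mN : measurable (affine_map (- a) b @^-1` A).
  by rewrite -[X in measurable X]setTI; exact: measurable_affine_map.
rewrite -[RHS]lebesgue_measureN//; congr (mu _).
by apply/seteqP; split => x /=; rewrite /affine_map mulrNN.
Qed.

Lemma ge0_integral_affine (a b : R) (f : R -> \bar R) : a != 0 ->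
  measurable_fun [set: R] f -> (forall x, 0 <= f x)%E ->
  (`|a|%:E * \int[mu]_x f (a * x + b)%R = \int[mu]_x f x)%E.
Proof.
move=> a0 mf f0.
have ma := @measurable_affine_map a b.
pose m1 : {measure set (measurableTypeR R) -> \bar R} :=
  measure_function_pushforward__canonical__measure_function_Measure mu ma.
have a0' : 0 <= `|a| by [].
transitivity (\int[mscale (NngNum a0') m1]_x f x)%E; last first.
  apply: eq_measure_integral => A mA _.
  by transitivity (`|a|%:E * mu (affine_map a b @^-1` A))%E; [|exact: lebesgue_measure_affine].
rewrite ge0_integral_mscale//=; congr (_ * _)%E.
by rewrite [in RHS]ge0_integral_pushforward.
Qed.

Lemma integral_affine (a b : R) (f : R -> \bar R) : a != 0 ->
  mu.-integrable setT f ->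
  (\int[mu]_x f (a * x + b)%R = `|a|^-1%:E * \int[mu]_x f x)%E.
Proof.
move=> a0 intf; have mf := measurable_int _ intf.
have key g : measurable_fun [set: R] g -> (forall x, 0 <= g x)%E ->
    (\int[mu]_x g (a * x + b)%R = `|a|^-1%:E * \int[mu]_x g x)%E.
  move=> mg g0; rewrite -(@ge0_integral_affine a b g)// muleA -EFinM.
  by rewrite mulVf ?normr_eq0// mul1e.
rewrite (_ : (fun x => f (a * x + b)) = f \o affine_map a b)//.
rewrite (integralE _ _ (f \o affine_map a b)). rewrite [in RHS](integralE mu setT f) funepos_comp funeneg_comp.
rewrite (key f^\+)%E//; last exact: measurable_funepos.
rewrite (key f^\-)%E//; last exact: measurable_funeneg.
apply/esym/muleBr => //.
exact: (integrable_add_def _ intf).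
Qed.

Lemma integrable_affine (a b : R) (f : R -> \bar R) : a != 0 ->
  mu.-integrable setT f -> mu.-integrable setT (fun x => f (a * x + b)%R).
Proof.
move=> a0 /integrableP[mf intf]; apply/integrableP; split.
  exact: (measurableT_comp mf (@measurable_affine_map a b)).
have := @ge0_integral_affine a b (abse \o f) a0; rewrite /= => h.
have {}h : (`|a|%:E * \int[mu]_x `|f (a * x + b)%R| < +oo)%E.
  by rewrite h//; exact: measurableT_comp.
have := @ge0_integral_affine a b (abse \o f) a0; rewrite /= => h'.
rewrite ltey; apply/eqP => E; move: h; rewrite E gt0_muley ?ltxx//.
by rewrite lte_fin normr_gt0.
Qed.

End affine.

(** * Integrable functions, improper integrals and the Poisson integral *)

Section L1.
Variable R : realType.
Implicit Types u v w : R -> R.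

Lemma L1_measurable u : L1 u -> measurable_fun setT u.
Proof. by move=> /(measurable_int mu)/measurable_EFinP. Qed.

Lemma L1_ext u v : (forall x, u x = v x) -> L1 u -> L1 v.
Proof. by move=> uv; rewrite (_ : u = v)//; exact/funext. Qed.

Lemma L1D u v : L1 u -> L1 v -> L1 (fun x => u x + v x).
Proof. by move=> iu iv; have := integrableD measurableT iu iv. Qed.

Lemma L1N u : L1 u -> L1 (fun x => - u x).
Proof. by move=> iu; have := integrableN iu. Qed.

Lemma L1B u v : L1 u -> L1 v -> L1 (fun x => u x - v x).
Proof. by move=> iu iv; exact: L1D iu (L1N iv). Qed.

Lemma L1Z (a : R) u : L1 u -> L1 (fun x => a * u x).
Proof. by move=> iu; have := integrableZl measurableT a iu. Qed.

Lemma L1_le u v : measurable_fun setT u -> L1 v ->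
  (forall x, `|u x| <= v x) -> L1 u.
Proof.
move=> mu' iv uv; apply: (le_integrable measurableT _ _ iv).
  exact/measurable_EFinP.
by move=> x _ /=; rewrite lee_fin (le_trans (uv x))// ler_norm.
Qed.

Lemma L1_norm u : L1 u -> L1 (fun x => `|u x|).
Proof. by move=> iu; have := integrable_norm iu. Qed.

Lemma L1_mul_bounded u (b : R -> R) (M : R) : L1 u -> measurable_fun setT b ->
  (forall x, `|b x| <= M) -> L1 (fun x => u x * b x).
Proof.
move=> iu mb bM.
apply: (@L1_le _ (fun x => M * `|u x|)).
- by apply: measurable_funM => //; exact: L1_measurable.
- exact/L1Z/L1_norm.
- by move=> x; rewrite normrM mulrC ler_wpM2r.
Qed.

Lemma L1_affine (a b : R) u : a != 0 -> L1 u -> L1 (fun x => u (a * x + b)).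
Proof. by move=> a0 iu; exact: (integrable_affine b a0 iu). Qed.

Lemma int_affine (a b : R) u : a != 0 -> L1 u ->
  \I (fun x => u (a * x + b)) = `|a|^-1 * \I u.
Proof.
move=> a0 iu; rewrite /Rintegral (integral_affine b a0 iu) fineM//.
exact: integrable_fin_num.
Qed.

Lemma intN u : L1 u -> \I (fun x => - u x) = - \I u.
Proof.
move=> iu; rewrite -mulN1r -RintegralZl//.
by apply: eq_Rintegral => x _; rewrite mulN1r.
Qed.

Lemma norm_int_le u v : L1 u -> L1 v -> (forall x, `|u x| <= v x) ->
  `|\I u| <= \I v.
Proof.
move=> iu iv uv; apply: (le_trans (le_normr_Rintegral measurableT iu)).
by apply: le_Rintegral => //; exact: L1_norm.
Qed.

Lemma dominated_convergenceR (D : set R) (f : nat -> R -> R) u (g : R -> R) :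
  measurable D ->
  (forall n, measurable_fun D (f n)) ->
  (forall x, D x -> f ^~ x @ \oo --> u x) ->
  mu.-integrable D (EFin \o g) ->
  (forall n x, D x -> `|f n x| <= g x) ->
  (fun n => \int[mu]_(x in D) f n x)%R @ \oo --> (\int[mu]_(x in D) u x)%R.
Proof.
move=> mD mf fu ig fg.
have mu' : measurable_fun D u by exact: (@measurable_fun_cvg _ _ _ D f u mf fu).
have h : {ae mu, forall x, D x -> (fun n => (f n x)%:E) @ \oo --> (u x)%:E}.
  by apply: aeW => x Dx; apply: cvg_EFin; [exact: nearW|exact: fu].
have fg' : {ae mu, forall x (n : nat), D x -> (`|(f n x)%:E| <= (g x)%:E)%E}.
  by apply: aeW => x n Dx; rewrite lee_fin; exact: fg.
have [iu _ cv] := @dominated_convergence _ _ R mu D mD (fun n x => (f n x)%:E)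
  (EFin \o u) (EFin \o g) (fun n => proj2 (measurable_EFinP _ _) (mf n))
  (proj2 (measurable_EFinP _ _) mu') h ig fg'.
have fin : (\int[mu]_(x in D) (u x)%:E)%E \is a fin_num by exact: integrable_fin_num.
rewrite /Rintegral; apply/fine_cvg; rewrite fineK//.
Qed.

Lemma integral_oneDsqrV : (\int[@lebesgue_measure R]_x ((1 + x ^+ 2)^-1)%:E = pi%:E)%E.
Proof.
rewrite (@ge0_symfun_integralT _ (fun x : R => (1 + x ^+ 2)^-1)).
- rewrite -set_itvcy integral0y_oneDsqr -EFinM; by congr EFin; field.
- by move=> x; rewrite invr_ge0 addr_ge0 ?sqr_ge0.
- exact: continuous_oneDsqrV.
- by move=> x /=; rewrite sqrrN.
Qed.

Lemma L1_oneDsqrV : L1 (fun x : R => (1 + x ^+ 2)^-1).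
Proof.
apply/integrableP; split.
  by apply/measurable_EFinP; apply: continuous_measurable_fun; exact: continuous_oneDsqrV.
under eq_integral => x _.
  rewrite /= ger0_norm; last by rewrite invr_ge0 addr_ge0 ?sqr_ge0.
  over.
by rewrite integral_oneDsqrV ltry.
Qed.

Lemma int_oneDsqrV : \I (fun x : R => (1 + x ^+ 2)^-1) = pi.
Proof. by rewrite /Rintegral integral_oneDsqrV. Qed.

(** The function 1/(1 + x^2) is the common majorant for Schwartz functions, exponentials and Poisson
    kernels. *)
Lemma L1_decay u (M : R) : measurable_fun setT u ->
  (forall x, `|u x| <= M * (1 + x ^+ 2)^-1) -> L1 u.
Proof. by move=> mu' uM; apply: L1_le (L1Z M L1_oneDsqrV) uM. Qed.

(** Dominated convergence for the restrictions of [u] to [B n], with majorant |u|. It carries the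
    fundamental theorem of calculus over to unbounded intervals, where integrability lets the
    endpoints run through the integers only. *)
Lemma int_exhaustion_cvg (D : set R) (B : nat -> set R) u :
  measurable D -> mu.-integrable D (EFin \o u) ->
  (forall n, measurable (B n)) -> (forall n, B n `<=` D) ->
  (forall x, D x -> \forall n \near \oo, B n x) ->
  (fun n => \int[mu]_(x in B n) u x)%R @ \oo --> (\int[mu]_(x in D) u x)%R.
Proof.
move=> mD iu mB BD cB.
have mu' : measurable_fun D u by apply/measurable_EFinP; exact: measurable_int iu.
have E n : (\int[mu]_(x in B n) u x)%R = (\int[mu]_(x in D) (u \_ (B n)) x)%R.
  by rewrite -Rintegral_mkcondr; congr (Rintegral mu _ u); apply/esym/setIidr.
under eq_fun do rewrite E.
apply: (@dominated_convergenceR D _ _ (fun x => `|u x|)) => //.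
- move=> n; apply/(measurable_restrict _ (mB n) mD).
  by apply: measurable_funS mu' => // x [].
- move=> x Dx; apply: cvg_near_cst; near=> n.
  by rewrite patchE mem_set//; near: n; exact: cB.
- exact: integrable_norm.
- by move=> n x Dx; rewrite patchE; case: ifP => // _; rewrite normr0.
Unshelve. all: by end_near. Qed.

Lemma FTC_itv (F f : R -> R) (a b : R) : a < b -> (forall x : R, is_derive x 1 F (f x)) ->
  continuous f -> (\int[mu]_(x in `[a, b]) f x)%R = F b - F a.
Proof.
move=> ab dF cf.
have cF : continuous F by move=> x; apply/differentiable_continuous/derivable1_diffP; case: (dF x).
rewrite /Rintegral (@continuous_FTC2 _ _ F)//.
- exact: continuous_subspaceT.
- split.
  + by move=> x _; case: (dF x).
  + by apply: cvg_at_right_filter; exact: cF.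
  + by apply: cvg_at_left_filter; exact: cF.
- by move=> x _; rewrite derive1E; exact: derive_val.
Qed.

Lemma FTC_line (F f : R -> R) (l1 l2 : R) : (forall x : R, is_derive x 1 F (f x)) ->
  continuous f -> L1 f ->
  (fun n : nat => F n%:R) @ \oo --> l1 -> (fun n : nat => F (- n%:R)) @ \oo --> l2 ->
  \I f = l1 - l2.
Proof.
move=> dF cf iF c1 c2.
have h := @int_exhaustion_cvg setT (fun n => `[- n%:R, n%:R]%classic) f measurableT iF.
have {}h : (fun n : nat => \int[mu]_(x in `[- n%:R, n%:R]) f x)%R @ \oo --> \I f.
  apply: h => // x _; near=> n => /=.
  rewrite in_itv/= -ler_norml; near: n; exact: nbhs_infty_ger.
rewrite -(cvg_lim (@Rhausdorff R) h); apply: cvg_lim => //.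
apply: cvg_trans (cvgB c1 c2); apply: near_eq_cvg; near=> n.
rewrite (@FTC_itv F)// -subr_gt0 opprK -mulr2n pmulrn_lgt0// ltr0n.
by near: n; exists 1%N.
Unshelve. all: by end_near. Qed.

Lemma FTC_half_line (F f : R -> R) (l : R) : (forall x : R, is_derive x 1 F (f x)) ->
  continuous f -> mu.-integrable `[0, +oo[ (EFin \o f) ->
  (fun n : nat => F n%:R) @ \oo --> l ->
  (\int[mu]_(x in `[0, +oo[) f x)%R = l - F 0.
Proof.
move=> dF cf iF c1.
have h := @int_exhaustion_cvg `[0, +oo[ (fun n => `[0, n%:R]%classic) f _ iF.
have {}h : (fun n : nat => \int[mu]_(x in `[0, n%:R]) f x)%R @ \oo -->
    (\int[mu]_(x in `[0, +oo[) f x)%R.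
  apply: h => //.
  - by move=> n x /=; rewrite !in_itv/= andbT => /andP[].
  - move=> x /=; rewrite in_itv/= andbT => x0; near=> n => /=.
    rewrite in_itv/= x0/=; near: n; exact: nbhs_infty_ger.
rewrite -(cvg_lim (@Rhausdorff R) h); apply: cvg_lim => //.
apply: cvg_trans (cvgB c1 (cvg_cst (F 0))); apply: near_eq_cvg; near=> n.
by rewrite (@FTC_itv F)// ltr0n; near: n; exists 1%N.
Unshelve. all: by end_near. Qed.

Lemma int_even u : L1 u -> (forall x, u (- x) = u x) ->
  \I u = 2 * (\int[mu]_(x in `[0, +oo[) u x)%R.
Proof.
move=> iu ue.
have m0 : measurable (`]-oo, 0[ : set R) by [].
have m1 : measurable (`[0, +oo[ : set R) by [].
have -> : \I u = (\int[mu]_(x in `]-oo, 0[) u x)%R + (\int[mu]_(x in `[0, +oo[) u x)%R.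
  have -> : [set: R] = `]-oo, 0[ `|` `[0, +oo[.
    apply/seteqP; split => x //= _; rewrite !in_itv/= andbT.
    by case: (ltP x 0) => _; [left|right].
  rewrite Rintegral_setU//.
  - by apply: integrableS iu => //; exact: measurableU.
  - apply/disj_set2P/seteqP; split => x //=; rewrite !in_itv/= andbT.
    by move=> [] /lt_le_trans h /h; rewrite ltxx.
rewrite mulrDl mul1r; congr (_ + _).
(* Dropping the point 0 makes the right-hand domain the exact mirror image of []-oo, 0[]. *)
rewrite -[RHS]Rintegral_itv_obnd_cbnd; last exact: integrableS iu.
rewrite Rintegral_mkcond [RHS]Rintegral_mkcond.
have iu0 : L1 (u \_ `]-oo, 0[).
  rewrite -restrict_EFin -(@integrable_mkcond _ _ _ mu _ _ m0).
  exact: integrableS iu.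
have := @int_affine (-1) 0 _ _ iu0; rewrite oppr_eq0 oner_eq0 normrN1 invr1 mul1r => <- //.
apply: eq_Rintegral => x _; rewrite !patchE mulN1r addr0 ue.
congr (if _ then _ else _); apply/idP/idP => /set_mem /=; rewrite in_itv/= => h; apply/mem_set => /=.
  by rewrite in_itv/= andbT -oppr_lt0.
by move: h; rewrite in_itv/= andbT oppr_lt0.
Qed.

Lemma exp_decay_cvg (g : R -> R) : (forall x, `|g x| <= 1) ->
  (fun n : nat => expR (- n%:R) * g n%:R) @ \oo --> (0 : R).
Proof.
move=> g1; apply: norm_cvg0; apply: (@squeeze_cvgr _ _ _ _ (cst 0) (fun n : nat => n.+1%:R^-1)).
- apply: nearW => n; rewrite normr_ge0/= normrM ger0_norm ?expR_ge0//.
  apply: le_trans (ler_piMr (expR_ge0 _) (g1 _)) _.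
  rewrite expRN lef_pV2 ?posrE ?expR_gt0 ?ltr0n//.
  by apply: le_trans (expR_ge1Dx _); rewrite -natr1 addrC.
- exact: cvg_cst.
- exact: cvg_harmonic.
Qed.

Lemma L1_expN : L1 (fun x : R => expR (- `|x|)).
Proof.
(* The constant comes from e^|x| >= (1 + |x|/2)^2 >= (1 + x^2)/4. *)
apply: (@L1_decay _ 4).
  apply: continuous_measurable_fun => x.
  apply: continuous_comp; last exact: continuous_expR.
  by apply: cvgN; exact: norm_continuous.
move=> x; rewrite ger0_norm ?expR_ge0// expRN -[leRHS]invrK lef_pV2 ?posrE ?expR_gt0//.
  rewrite invfM invrK.
  have -> : `|x| = `|x| / 2 + `|x| / 2 by rewrite -splitr.
  have h := expR_ge1Dx (`|x| / 2).
  have n0 := normr_ge0 x.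
  rewrite expRD; apply: (@le_trans _ _ ((1 + `|x| / 2) * (1 + `|x| / 2))).
    by rewrite -(real_normK (num_real x)); nra.
  by apply: ler_pM => //; rewrite addr_ge0// divr_ge0.
by rewrite invr_gt0 mulr_gt0// invr_gt0 (lt_le_trans ltr01)// lerDl sqr_ge0.
Qed.

Lemma int_poisson (t : R) :
  \I (fun x => expR (- `|x|) * cos (x * t)) = 2 / (1 + t ^+ 2).
Proof.
have d0 : 1 + t ^+ 2 != 0 by rewrite gt_eqF// (lt_le_trans ltr01)// lerDl sqr_ge0.
have cc : continuous (fun x : R => cos (x * t)).
  move=> x; apply: continuous_comp; [exact: mulrr_continuous|exact: continuous_cos].
have iu : L1 (fun x => expR (- `|x|) * cos (x * t)).
  apply: (@L1_mul_bounded _ _ 1 L1_expN (continuous_measurable_fun cc)) => x.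
  exact: norm_cos_le1.
rewrite int_even//; last by move=> x; rewrite normrN mulNr cosN.
congr (_ * _).
(* The real part of e^((-1 + it)x) / (-1 + it), an antiderivative on the half-line, where |x| =
   x. *)
pose F (x : R) := expR (- x) * (t * sin (x * t) - cos (x * t)) / (1 + t ^+ 2).
have -> : (\int[mu]_(x in `[0, +oo[) (expR (- `|x|) * cos (x * t)) =
  \int[mu]_(x in `[0, +oo[) (expR (- x) * cos (x * t)))%R.
  by apply: eq_Rintegral => x; rewrite inE/= in_itv/= andbT => x0; rewrite ger0_norm.
have dF (x : R) : is_derive x 1 F (expR (- x) * cos (x * t)).
  rewrite /F; apply: is_derive_eq.
  rewrite /GRing.scale/=; field; exact: d0.
rewrite (@FTC_half_line F _ 0 dF).
- by rewrite /F oppr0 expR0 !mul0r sin0 cos0 mulr0 !sub0r mul1r mulNr opprK mul1r.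
- move=> x; apply: cvgM; last exact: cc.
  apply: continuous_comp; [exact: opp_continuous|exact: continuous_expR].
- have m0 : measurable (`[0, +oo[ : set R) by [].
  have iu0 : mu.-integrable `[0, +oo[ (EFin \o (fun x => expR (- `|x|) * cos (x * t))).
    exact: integrableS iu.
  apply: (@eq_integrable _ _ _ mu _ m0 _ _ _ iu0) => x; rewrite inE/= in_itv/= andbT => x0.
  by rewrite ger0_norm.
- rewrite /F.
  (* The oscillating factor normalised to be bounded by 1, as [exp_decay_cvg] asks. *)
  pose g (x : R) := (t * sin (x * t) - cos (x * t)) / (1 + `|t|).
  have g1 x : `|g x| <= 1.
    rewrite /g normrM normfV [`|1 + _|]ger0_norm ?addr_ge0// ler_pdivrMr ?ltr_pwDl// mul1r [leRHS]addrC.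
    apply: le_trans (ler_normB _ _) _; rewrite lerD//.
      by rewrite normrM ler_piMr// norm_sin_le1.
    exact: norm_cos_le1.
  have -> : (fun n : nat => expR (- n%:R) * (t * sin (n%:R * t) - cos (n%:R * t)) / (1 + t ^+ 2))
    = (fun n : nat => (1 + `|t|) / (1 + t ^+ 2) * (expR (- n%:R) * g n%:R)).
    apply/funext => n; rewrite /g; field; rewrite d0/= gt_eqF// ltr_pwDl//.
  rewrite -[X in _ --> X](mulr0 ((1 + `|t|) / (1 + t ^+ 2))).
  by apply: cvgMr; exact: exp_decay_cvg.
Qed.

End L1.

(** * Cosine and sine transforms, Plancherel identity *)

(** The kernel is a parameter so that the cosine and sine transforms share their proofs; no factor
    1/sqrt(2 pi) is included. *)
Definition trigT (R : realType) (k u : R -> R) (xi : R) : R :=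
  (\int[@lebesgue_measure R]_x (u x * k (x * xi)))%R.

Local Notation cosT := (trigT (@cos _)).
Local Notation sinT := (trigT (@sin _)).

Section trigT.
Variable R : realType.
Implicit Types u v w : R -> R.

Lemma EFin_int u : L1 u -> (\I u)%:E = (\int[mu]_x (u x)%:E)%E.
Proof. by move=> iu; rewrite /Rintegral fineK//; exact: integrable_fin_num. Qed.

Section kernel.
Variable k : R -> R.
Hypotheses (ck : continuous k) (k1 : forall x, `|k x| <= 1).

Lemma L1_trig u xi : L1 u -> L1 (fun x => u x * k (x * xi)).
Proof.
move=> iu; apply: (@L1_mul_bounded _ _ _ 1 iu) => // .
apply: continuous_measurable_fun => x.
by apply: continuous_comp; [exact: mulrr_continuous|exact: ck].
Qed.

Lemma trigT_bound u xi : L1 u -> `|trigT k u xi| <= \I (fun x => `|u x|).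
Proof.
move=> iu; apply: norm_int_le; [exact: L1_trig|exact: L1_norm|].
by move=> x; rewrite normrM ler_piMr.
Qed.

Lemma trigTZ (a : R) u xi : L1 u -> trigT k (fun x => a * u x) xi = a * trigT k u xi.
Proof.
move=> iu; rewrite /trigT -RintegralZl//; last exact: L1_trig.
by apply: eq_Rintegral => x _; rewrite mulrA.
Qed.

Lemma trigTB u v xi : L1 u -> L1 v ->
  trigT k (fun x => u x - v x) xi = trigT k u xi - trigT k v xi.
Proof.
move=> iu iv; rewrite /trigT -RintegralB//; [|exact: L1_trig..].
by apply: eq_Rintegral => x _; rewrite mulrBl.
Qed.

Lemma trigT_continuous u : L1 u -> continuous (trigT k u).
Proof.
move=> iu xi.
apply: (@continuity_under_integral _ _ _ mu (fun xi x => u x * k (x * xi)) setT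
  measurableT (xi - 1) (xi + 1) _ _ (fun x => `|u x|)).
- by move=> y _; exact: L1_trig.
- apply: aeW => x _ y _.
  apply: cvgMr; apply: (@continuous_comp _ _ _ (fun y => x * y) k);
    [exact: mulrl_continuous|exact: ck].
- exact: L1_norm.
- by move=> y _; apply: aeW => x _; rewrite normrM ler_piMr.
- by rewrite inE/= in_itv/= ltrBlDr !ltrDl ltr01.
Qed.

(** Self-adjointness of the transform: the kernel k(x y) is symmetric and bounded, so Fubini applies
    to u(x) v(y) k(x y). *)
Lemma trigT_swap u v : L1 u -> L1 v ->
  \I (fun y => v y * trigT k u y) = \I (fun x => u x * trigT k v x).
Proof.
move=> iu iv.
pose f (z : R * R) : \bar R := (u z.1 * v z.2 * k (z.1 * z.2))%:E.
have mf : measurable_fun setT f.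
  apply/measurable_EFinP; apply: measurable_funM.
    apply: measurable_funM.
      by apply: (measurableT_comp (L1_measurable iu)); exact: measurable_fst.
    by apply: (measurableT_comp (L1_measurable iv)); exact: measurable_snd.
  apply: (measurableT_comp (continuous_measurable_fun ck)).
  by apply: measurable_funM; [exact: measurable_fst|exact: measurable_snd].
have Fy x : (\int[mu]_y f (x, y))%E = (u x * trigT k v x)%:E.
  rewrite /trigT -RintegralZl//; last exact: L1_trig.
  rewrite EFin_int//; last by apply: L1Z; exact: L1_trig.
  by apply: eq_integral => y _; rewrite /f/= mulrA [y * x]mulrC.
have Fx y : (\int[mu]_x f (x, y))%E = (v y * trigT k u y)%:E.
  rewrite /trigT -RintegralZl//; last exact: L1_trig.
  rewrite EFin_int//; last by apply: L1Z; exact: L1_trig.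
  by apply: eq_integral => x _; rewrite /f/= mulrA [u x * _]mulrC.
have intf : (mu \x mu)%E.-integrable setT f.
  apply/integrable12ltyP => //.
  have h : L1 (fun x => `|u x| * \I (fun y => `|v y|)).
    by apply: L1_ext (L1Z (\I (fun y => `|v y|)) (L1_norm iu)) => x; rewrite mulrC.
  apply: (@le_lt_trans _ _ (\int[mu]_x (`|u x| * \I (fun y => `|v y|))%:E)%E); last first.
    by rewrite -EFin_int// ltry.
  apply: ge0_le_integral => //.
  - by move=> x _; apply: integral_ge0.
  - apply: (@measurable_fun_fubini_tonelli_F _ _ _ _ R mu (fun z => `|f z|%E)) => //.
    exact: measurableT_comp.
  - exact: measurable_int h.
  - move=> x _.
    have h' : L1 (fun y => `|u x| * `|v y|) by apply/L1Z/L1_norm.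
    rewrite -RintegralZl//; last exact: L1_norm.
    rewrite EFin_int//.
    apply: ge0_le_integral => //.
    + apply/measurable_EFinP/measurableT_comp => //.
      apply: (@measurable_funM _ _ _ _ (fun y => u x * v y)); first exact: L1_measurable (L1Z (u x) iv).
      apply: continuous_measurable_fun => y.
      by apply: continuous_comp; [exact: mulrl_continuous|exact: ck].
    + exact: measurable_int h'.
    + by move=> y _; rewrite /f/= lee_fin !normrM ler_piMr// mulr_ge0.
have := @Fubini _ _ _ _ R mu mu f intf.
under eq_integral do rewrite Fy.
under [X in _ = X]eq_integral do rewrite Fx.
by rewrite /Rintegral => ->.
Qed.

End kernel.

(** The convolution of [u] with the Poisson kernel of width [e] and mass 2 pi, after the
    substitution y = e t + eta. In this form it also makes sense at e = 0, where it is 2 pi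
    u(eta). *)
Definition poisson_mean (u : R -> R) (e eta : R) : R :=
  \I (fun t => u (e * t + eta) * (2 / (1 + t ^+ 2))).

Lemma poisson_kernel (e t : R) : 0 < e ->
  \I (fun x => expR (- `|e * x|) * cos (x * t)) = 2 / (e * (1 + (t / e) ^+ 2)).
Proof.
move=> e0; have ne0 : e != 0 by rewrite gt_eqF.
have iw : L1 (fun x => expR (- `|x|) * cos (x * (t / e))).
  exact: (L1_trig cc c1 _ (@L1_expN R)).
have := int_affine 0 ne0 iw; rewrite int_poisson gtr0_norm// invfM mulrCA => <-.
by apply: eq_Rintegral => x _; rewrite addr0; congr (_ * cos _); field.
Qed.

(** Self-adjointness moves both transforms off the squares and onto the weight. The cosine and sine
    contributions then combine by cos(x y) cos(x eta) + sin(x y) sin(x eta) = cos(x (y - eta)),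
    whose weighted integral is the Poisson kernel at y - eta. *)
Lemma plancherel_weighted u (e : R) : L1 u -> continuous u -> 0 < e ->
  \I (fun x => expR (- `|e * x|) * (cosT u x ^+ 2 + sinT u x ^+ 2)) =
  \I (fun eta => u eta * poisson_mean u e eta).
Proof.
move=> iu cu e0; have ne0 : e != 0 by rewrite gt_eqF.
pose w x := expR (- `|e * x|).
have iw : L1 w.
  by apply: L1_ext (L1_affine 0 ne0 (@L1_expN R)) => x; rewrite /w addr0.
have iwT k : continuous k -> (forall x, `|k x| <= 1) -> L1 (fun x => w x * trigT k u x).
  move=> ck k1; apply: (L1_mul_bounded iw (continuous_measurable_fun (trigT_continuous ck k1 iu))).
  by move=> x; exact: trigT_bound.
(* Two applications of [trigT_swap]: one for the outer factor of the square, one for the inner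
   factor at fixed [eta]. *)
have step k : continuous k -> (forall x, `|k x| <= 1) ->
    \I (fun x => w x * trigT k u x ^+ 2) =
    \I (fun eta => u eta * \I (fun y => u y * trigT k (fun x => w x * k (x * eta)) y)).
  move=> ck k1.
  have -> : (fun x => w x * trigT k u x ^+ 2) = (fun x => (w x * trigT k u x) * trigT k u x).
    by apply/funext => x; rewrite expr2 mulrA.
  rewrite (trigT_swap ck k1 iu (iwT k ck k1)).
  apply: eq_Rintegral => eta _; congr (_ * _).
  rewrite -trigT_swap//; last exact: L1_trig.
  by apply: eq_Rintegral => x _; rewrite mulrAC.
have int1 k : continuous k -> (forall x, `|k x| <= 1) -> L1 (fun x => w x * trigT k u x ^+ 2).
  move=> ck k1.
  have h := L1_mul_bounded (iwT k ck k1) (continuous_measurable_fun (trigT_continuous ck k1 iu))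
    (fun x => trigT_bound ck k1 x iu).
  by apply: L1_ext h => x; rewrite expr2 mulrA.
have intu k eta : continuous k -> (forall x, `|k x| <= 1) ->
    L1 (fun y => u y * trigT k (fun x => w x * k (x * eta)) y).
  move=> ck k1.
  have iwk : L1 (fun x => w x * k (x * eta)) by exact: L1_trig.
  apply: (L1_mul_bounded iu (continuous_measurable_fun (trigT_continuous ck k1 iwk))).
  by move=> y; exact: trigT_bound.
have intu2 k : continuous k -> (forall x, `|k x| <= 1) ->
    L1 (fun eta => u eta * \I (fun y => u y * trigT k (fun x => w x * k (x * eta)) y)).
  move=> ck k1.
  have E eta : \I (fun y => u y * trigT k (fun x => w x * k (x * eta)) y) =
     trigT k (fun x => w x * trigT k u x) eta.
    rewrite -trigT_swap//; last exact: L1_trig.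
    by apply: eq_Rintegral => x _; rewrite mulrAC.
  under eq_fun do rewrite E.
  have h := iwT k ck k1.
  apply: (L1_mul_bounded iu (continuous_measurable_fun (trigT_continuous ck k1 h))).
  by move=> y; exact: trigT_bound.
transitivity (\I (fun x => w x * cosT u x ^+ 2) + \I (fun x => w x * sinT u x ^+ 2)).
  rewrite -RintegralD//; [|exact: (int1 _ cc c1)|exact: (int1 _ cs s1)].
  by apply: eq_Rintegral => x _; rewrite mulrDr.
rewrite (step _ cc c1) (step _ cs s1) -RintegralD//;
  [|exact: (intu2 _ cc c1)|exact: (intu2 _ cs s1)].
apply: eq_Rintegral => eta _; rewrite -mulrDr; congr (_ * _).
rewrite -RintegralD//; [|exact: (intu _ _ cc c1)|exact: (intu _ _ cs s1)].
have K y : cosT (fun x => w x * cos (x * eta)) y + sinT (fun x => w x * sin (x * eta)) y =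
    2 / (e * (1 + ((y - eta) / e) ^+ 2)).
  rewrite -poisson_kernel// /trigT -RintegralD//.
  - apply: eq_Rintegral => x _; rewrite -!mulrA -mulrDr; congr (_ * _).
    by rewrite mulrBr cosB mulrC [sin _ * _]mulrC.
  - by apply: (L1_trig cc c1); exact: (L1_trig cc c1).
  - by apply: (L1_trig cs s1); exact: (L1_trig cs s1).
under eq_Rintegral => y _ do rewrite -mulrDr K.
have iuK : L1 (fun y => u y * (2 / (1 + ((y - eta) / e) ^+ 2))).
  have den0 (y : R) : 0 < 1 + ((y - eta) / e) ^+ 2.
    by rewrite (lt_le_trans ltr01)// lerDl sqr_ge0.
  apply: (@L1_mul_bounded _ _ _ 2 iu).
    apply: continuous_measurable_fun => y; apply: cvgMr; apply: cvgV; first by rewrite gt_eqF.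
    apply: cvgD; first exact: cvg_cst.
    apply: cvgM; apply: cvgMl; (apply: cvgB; [exact: cvg_id|exact: cvg_cst]).
  move=> y; rewrite ger0_norm; last exact: divr_ge0 (ltW (den0 y)).
  by rewrite ler_pdivrMr// ler_peMr// lerDl sqr_ge0.
have := int_affine eta ne0 iuK; rewrite gtr0_norm// => h.
transitivity (e^-1 * \I (fun y => u y * (2 / (1 + ((y - eta) / e) ^+ 2)))).
  rewrite -RintegralZl//; apply: eq_Rintegral => y _.
  by rewrite invfM; ring.
rewrite -h; apply: eq_Rintegral => t _; rewrite addrK.
by rewrite [e * t]mulrC mulfK.
Qed.

Lemma poisson_mean_bound u (e eta M : R) : continuous u -> (forall x, `|u x| <= M) ->
  `|poisson_mean u e eta| <= M * (2 * pi).
Proof.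
move=> cu uM.
have iK : L1 (fun t => M * (2 * (1 + t ^+ 2)^-1)) by do 2 apply: L1Z; exact: L1_oneDsqrV.
rewrite -int_oneDsqrV -RintegralZl//; last exact: L1_oneDsqrV.
rewrite -RintegralZl//; last by apply: L1Z; exact: L1_oneDsqrV.
have uKM t : `|u (e * t + eta) * (2 / (1 + t ^+ 2))| <= M * (2 * (1 + t ^+ 2)^-1).
  rewrite normrM [`|2 / _|]ger0_norm.
    by rewrite ler_wpM2r// divr_ge0// addr_ge0 ?sqr_ge0.
  by rewrite divr_ge0// addr_ge0 ?sqr_ge0.
apply: norm_int_le => //.
apply: L1_le iK uKM.
apply: continuous_measurable_fun => t; apply: cvgM.
  apply: (@continuous_comp _ _ _ (fun t => e * t + eta) u); last exact: cu.
  by apply: cvgD; [exact: mulrl_continuous|exact: cvg_cst].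
by apply: cvgMr; exact: continuous_oneDsqrV.
Qed.

Lemma poisson_mean0 u eta : poisson_mean u 0 eta = 2 * pi * u eta.
Proof.
rewrite /poisson_mean; under eq_Rintegral => t _ do rewrite mul0r add0r.
rewrite RintegralZl//; last by apply: L1Z; exact: L1_oneDsqrV.
rewrite RintegralZl//; last exact: L1_oneDsqrV.
by rewrite int_oneDsqrV mulrC.
Qed.

(** Letting both parameters move covers two uses at once: continuity in [eta] for fixed [e], and the
    limit e -> 0 at fixed [eta]. *)
Lemma poisson_mean_cvg u (M : R) (e eta : nat -> R) (e0 eta0 : R) :
  continuous u -> (forall x, `|u x| <= M) ->
  e @ \oo --> e0 -> eta @ \oo --> eta0 ->
  (fun n => poisson_mean u (e n) (eta n)) @ \oo --> poisson_mean u e0 eta0.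
Proof.
move=> cu uM ee0 ete0.
have cK : continuous (fun t : R => 2 / (1 + t ^+ 2)).
  by move=> t; apply: cvgMr; exact: continuous_oneDsqrV.
apply: (@dominated_convergenceR _ setT _ _ (fun t => M * (2 * (1 + t ^+ 2)^-1))) => //.
- move=> n; apply: continuous_measurable_fun => t; apply: cvgM; last exact: cK.
  apply: (@continuous_comp _ _ _ (fun t => e n * t + eta n) u); last exact: cu.
  by apply: cvgD; [exact: mulrl_continuous|exact: cvg_cst].
- move=> t _; apply: cvgMl.
  apply: (@cvg_comp _ _ _ (fun n => e n * t + eta n) u _ _ _ _ (cu _)).
  by apply: cvgD => //; exact: cvgMl.
- by do 2 apply: L1Z; exact: L1_oneDsqrV.
- move=> n t _; rewrite normrM [`|2 / _|]ger0_norm.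
    by rewrite ler_wpM2r// divr_ge0// addr_ge0 ?sqr_ge0.
  by rewrite divr_ge0// addr_ge0 ?sqr_ge0.
Qed.

Lemma poisson_mean_continuous u (M e : R) : continuous u -> (forall x, `|u x| <= M) ->
  continuous (poisson_mean u e).
Proof.
move=> cu uM eta; apply/(@cvg_nbhsP _ R^o) => x xeta.
by apply: poisson_mean_cvg uM _ _ => //; exact: cvg_cst.
Qed.

Lemma L1_sqr u (M : R) : L1 u -> (forall x, `|u x| <= M) -> L1 (fun x => u x ^+ 2).
Proof.
move=> iu uM; have := L1_mul_bounded iu (L1_measurable iu) uM; apply: L1_ext => x.
by rewrite expr2.
Qed.

(** The weighted identity with e = 1/(n+1). The transform side increases with n, so monotone
    convergence applies without knowing that the squares are integrable; the extended-real equality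
    then yields that integrability too. The other side converges by domination, with majorant a
    multiple of |u|. *)
Lemma plancherel u (M : R) : L1 u -> continuous u -> (forall x, `|u x| <= M) ->
  (\int[mu]_x (cosT u x ^+ 2 + sinT u x ^+ 2)%:E = (2 * pi * \I (fun x => u x ^+ 2))%:E)%E.
Proof.
move=> iu cu uM.
pose e (n : nat) : R := n.+1%:R^-1.
have e_gt0 n : 0 < e n by rewrite invr_gt0 ltr0n.
pose f n x := expR (- `|e n * x|) * (cosT u x ^+ 2 + sinT u x ^+ 2).
have cCS : continuous (fun x => cosT u x ^+ 2 + sinT u x ^+ 2).
  move=> x; apply: cvgD; (apply: cvgM).
  - exact: (trigT_continuous cc c1).
  - exact: (trigT_continuous cc c1).
  - exact: (trigT_continuous cs s1).
  - exact: (trigT_continuous cs s1).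
have CS0 x : 0 <= cosT u x ^+ 2 + sinT u x ^+ 2 by rewrite addr_ge0 ?sqr_ge0.
have cf n : continuous (f n).
  move=> x; apply: cvgM; last exact: cCS.
  apply: continuous_comp; last exact: continuous_expR.
  by apply: cvgN; apply: cvg_norm; exact: mulrl_continuous.
have fE n : (\int[mu]_x (f n x)%:E)%E = (\I (fun eta => u eta * poisson_mean u (e n) eta))%:E.
  rewrite -plancherel_weighted//; apply/esym/EFin_int.
  apply: (@L1_le _ _ (fun x => (expR (- `|e n * x|)) * ((\I (fun x => `|u x|)) ^+ 2 *+ 2))).
  - exact: (continuous_measurable_fun (cf n)).
  - have ne0 : e n != 0 by rewrite gt_eqF.
    apply: L1_ext (L1Z ((\I (fun x => `|u x|)) ^+ 2 *+ 2) (L1_affine 0 ne0 (@L1_expN R))) => x.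
    by rewrite addr0 mulrC.
  - move=> x; rewrite /f normrM (ger0_norm (expR_ge0 _)) ler_wpM2l ?expR_ge0//.
    rewrite ger0_norm// mulr2n -[cosT u x ^+ 2]real_normK ?num_real// -[sinT u x ^+ 2]real_normK ?num_real//.
    by rewrite lerD// lerXn2r// ?nnegrE ?Rintegral_ge0// (trigT_bound cc c1, trigT_bound cs s1).
have lim1 : (fun n => \int[mu]_x (f n x)%:E)%E @ \oo -->
    (\int[mu]_x (cosT u x ^+ 2 + sinT u x ^+ 2)%:E)%E.
  have g0 n x : setT x -> (0 <= (f n x)%:E)%E by rewrite lee_fin mulr_ge0 ?expR_ge0.
  have nd x : setT x -> nondecreasing_seq (fun n => (f n x)%:E).
    move=> _ m n mn; rewrite lee_fin ler_wpM2r// ler_expR lerN2 !normrM ler_wpM2r//.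
    by rewrite !gtr0_norm// lef_pV2 ?posrE ?ltr0n// ler_nat.
  have mf n : measurable_fun setT (fun x => (f n x)%:E).
    by apply/measurable_EFinP; exact: (continuous_measurable_fun (cf n)).
  have := @cvg_monotone_convergence _ _ R mu setT measurableT _ mf g0 nd.
  congr (_ --> _); apply: eq_integral => x _; apply/cvg_lim => //.
  apply: cvg_EFin; first exact: nearW.
  rewrite -[X in _ --> X]mul1r; apply: cvgMl.
  have -> : 1 = expR (- `|0 * x|) :> R by rewrite mul0r normr0 oppr0 expR0.
  apply: (@cvg_comp _ _ _ _ _ _ (nbhs (- `|0 * x|))); last exact: continuous_expR.
  by apply: cvgN; apply: cvg_norm; apply: cvgMl; exact: cvg_harmonic.
have lim2 : (fun n => \int[mu]_x (f n x)%:E)%E @ \oo -->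
    ((2 * pi * \I (fun x => u x ^+ 2))%:E)%E.
  under eq_fun do rewrite fE.
  apply: cvg_EFin; first exact: nearW.
  rewrite -RintegralZl//; last exact: L1_sqr uM.
  apply: (@dominated_convergenceR _ setT _ _ (fun x => (M * (2 * pi)) * `|u x|)) => //.
  - move=> n; apply: measurable_funM; first exact: L1_measurable.
    exact: (continuous_measurable_fun (@poisson_mean_continuous u M (e n) cu uM)).
  - move=> x _; rewrite expr2 mulrA [_ * u x]mulrC; apply: cvgMr.
    rewrite -poisson_mean0; apply: poisson_mean_cvg uM _ _ => //; last exact: cvg_cst.
    exact: cvg_harmonic.
  - exact/L1Z/L1_norm.
  - by move=> n x _; rewrite normrM mulrC ler_wpM2r// poisson_mean_bound.
exact: (cvg_unique _ lim1 lim2).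
Qed.

End trigT.

(** * Schwartz functions *)

Section schwartz_class.
Variable R : realType.
Implicit Types u v w : R -> R.

Definition rapid u := forall k : nat, exists M : R, forall x : R, `|x| ^+ k * `|u x| <= M.

(** Coinduction principle: a class of rapidly decreasing functions stable under differentiation
    consists of Schwartz functions. It replaces every computation of n-th derivatives by the choice
    of a stable class [K]. *)
Lemma real_schwartz_coind (K : (R -> R) -> Prop) :
  (forall u, K u -> rapid u /\
     exists2 u', (forall x : R, is_derive x 1 u (u' x)) & K u') ->
  forall u, K u -> S u.
Proof.
move=> H u Ku n.
suff /H[r [u' du' _]] : K (derive1n n u).
  by split=> // x; have := du' x => -[].
elim: n => [//|n IH]; rewrite derive1nS.
have [_ [u' du' Ku']] := H _ IH.
rewrite (_ : derive1 (derive1n n u) = u')//.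
by apply/funext => x; rewrite derive1E; exact: derive_val.
Qed.

Lemma schwartz_rapid u : S u -> rapid u.
Proof. by move=> /(_ 0%N)[_]. Qed.

Lemma schwartz_derive1 u : S u -> S (derive1 u).
Proof.
move=> Su n.
by have := Su n.+1; rewrite /derive1n iterSr.
Qed.

Lemma schwartz_is_derive u (x : R) : S u -> is_derive x 1 u ((derive1 u) x).
Proof.
move=> /(_ 0%N)[/(_ x) d _].
by apply: DeriveDef => //; rewrite derive1E.
Qed.

Lemma is_derive_continuous u u' : (forall x : R, is_derive x 1 u (u' x)) -> continuous u.
Proof.
move=> d x; apply/differentiable_continuous/derivable1_diffP.
by have := d x => -[].
Qed.

Lemma schwartz_continuous u : S u -> continuous u.
Proof. by move=> Su; apply: is_derive_continuous => x; exact: schwartz_is_derive. Qed.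

Lemma schwartz_bounded u : S u -> exists M, forall x, `|u x| <= M.
Proof. by move=> /schwartz_rapid/(_ 0%N)[M uM]; exists M => x; rewrite -[`|u x|]mul1r; exact: uM. Qed.

Lemma rapidD u v : rapid u -> rapid v -> rapid (fun x => u x + v x).
Proof.
move=> ru rv k; have [M uM] := ru k; have [N vN] := rv k; exists (M + N) => x.
apply: le_trans (lerD (uM x) (vN x)); rewrite -mulrDr ler_wpM2l ?exprn_ge0//.
exact: ler_normD.
Qed.

Lemma rapidZ (a : R) u : rapid u -> rapid (fun x => a * u x).
Proof.
move=> ru k; have [M uM] := ru k; exists (`|a| * M) => x.
by rewrite normrM mulrCA ler_wpM2l.
Qed.

Lemma rapidX u : rapid u -> rapid (fun x => x * u x).
Proof.
move=> ru k; have [M uM] := ru k.+1; exists M => x.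
by rewrite normrM mulrA -exprSr.
Qed.

Lemma rapid_le u v : rapid v -> (forall x, `|u x| <= `|v x|) -> rapid u.
Proof.
move=> rv uv k; have [M vM] := rv k; exists M => x.
by apply: le_trans (vM x); rewrite ler_wpM2l ?exprn_ge0.
Qed.

Lemma schwartzD u v : S u -> S v -> S (fun x => u x + v x).
Proof.
move=> Su Sv.
apply: (@real_schwartz_coind (fun w => exists a b, [/\ S a, S b & w = (fun x => a x + b x)])); last first.
  by exists u, v.
move=> _ [a [b [Sa Sb ->]]]; split; first by apply: rapidD; exact: schwartz_rapid.
exists (fun x => (derive1 a) x + (derive1 b) x) => [x|].
  have da := schwartz_is_derive x Sa; have db := schwartz_is_derive x Sb.
  exact: is_deriveD.
by exists (derive1 a), (derive1 b); split => //; exact: schwartz_derive1.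
Qed.

Lemma schwartzZ (c : R) u : S u -> S (fun x => c * u x).
Proof.
move=> Su.
apply: (@real_schwartz_coind (fun w => exists2 a, S a & w = (fun x => c * a x))); last by exists u.
move=> _ [a Sa ->]; split; first by apply: rapidZ; exact: schwartz_rapid.
exists (fun x => c * (derive1 a) x) => [x|].
  have da := schwartz_is_derive x Sa.
  exact: is_deriveZ.
by exists (derive1 a) => //; exact: schwartz_derive1.
Qed.

Lemma schwartzN u : S u -> S (fun x => - u x).
Proof.
move=> Su; have := schwartzZ (-1) Su; congr real_schwartz; apply/funext => x.
by rewrite mulN1r.
Qed.

Lemma schwartzB u v : S u -> S v -> S (fun x => u x - v x).
Proof. by move=> Su /schwartzN; exact: schwartzD. Qed.

(** Multiples x a(x) alone are not stable under differentiation, but sums x a + b are: the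
    derivative is x a' + (a + b'). *)
Lemma schwartzX u : S u -> S (fun x => x * u x).
Proof.
move=> Su.
apply: (@real_schwartz_coind (fun w => exists a b, [/\ S a, S b & w = (fun x => x * a x + b x)])); last first.
  (* The zero function is written as a multiple of [u], which makes it Schwartz by [schwartzZ]. *)
  exists u, (fun x => 0 * u x); split => //; first exact: schwartzZ.
  by apply/funext => x; rewrite mul0r addr0.
move=> _ [a [b [Sa Sb ->]]]; split.
  apply: rapidD; last exact: schwartz_rapid.
  by apply: rapidX; exact: schwartz_rapid.
exists (fun x => x * (derive1 a) x + (a x + (derive1 b) x)) => [x|].
  have da := schwartz_is_derive x Sa; have db := schwartz_is_derive x Sb.
  apply: is_derive_eq; rewrite /GRing.scale/=; ring.
exists (derive1 a), (fun x => a x + (derive1 b) x); split => //.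
  exact: schwartz_derive1.
by apply: schwartzD => //; exact: schwartz_derive1.
Qed.

Lemma rapid_L1 u : rapid u -> continuous u -> L1 u.
Proof.
move=> ru cu; have [M0 h0] := ru 0%N; have [M2 h2] := ru 2%N.
apply: (@L1_decay _ _ (M0 + M2)); first exact: continuous_measurable_fun.
move=> x; rewrite ler_pdivlMr; last by rewrite (lt_le_trans ltr01)// lerDl sqr_ge0.
rewrite mulrDr mulr1 lerD//; first by have := h0 x; rewrite mul1r.
by rewrite mulrC -real_normK ?num_real.
Qed.

Lemma schwartz_L1 u : S u -> L1 u.
Proof. by move=> Su; apply: rapid_L1; [exact: schwartz_rapid|exact: schwartz_continuous]. Qed.

(** Disposes of the boundary terms at both ends in the integration by parts. *)
Lemma rapid_cvg0 u (g : R -> R) (x : nat -> R) : rapid u -> (forall y, `|g y| <= 1) ->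
  (forall n, `|x n| = n%:R) -> (fun n => u (x n) * g (x n)) @ \oo --> (0 : R).
Proof.
move=> ru g1 xn; have [M0 h0] := ru 0%N; have [M h] := ru 1%N.
apply: norm_cvg0; apply: (@squeeze_cvgr _ _ _ _ (cst 0) (fun n : nat => (M0 + M) * n.+1%:R^-1)).
- apply: nearW => n; rewrite normr_ge0/= normrM ler_pdivlMr ?ltr0n//.
  apply: (@le_trans _ _ (`|u (x n)| * n.+1%:R)).
    by rewrite ler_wpM2r// ler_piMr.
  rewrite -natr1 mulrDr mulr1 addrC lerD//; first by have := h0 (x n); rewrite mul1r.
  by have := h (x n); rewrite expr1 xn mulrC.
- exact: cvg_cst.
- by rewrite -[X in _ --> X](mulr0 (M0 + M)); apply: cvgMr; exact: cvg_harmonic.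
Qed.

Section kernel.
Variables k k' : R -> R.
Hypotheses (dk : forall x : R, is_derive x 1 k (k' x)) (ck' : continuous k').
Hypotheses (k1 : forall x, `|k x| <= 1) (k'1 : forall x, `|k' x| <= 1).

Let ck : continuous k. Proof. exact: is_derive_continuous dk. Qed.

Let is_derive_dilation (x xi : R) : is_derive x 1 (fun x => k (x * xi)) (xi * k' (x * xi)).
Proof.
rewrite mulrC; apply: (@is_derive1_comp _ k (fun x => x * xi) x (k' (x * xi)) xi).
by apply: is_derive_eq; rewrite /GRing.scale/= mulr0 add0r mulr1.
Qed.

Lemma trigT_by_parts u xi : S u -> trigT k (derive1 u) xi = - (xi * trigT k' u xi).
Proof.
move=> Su.
have iu := schwartz_L1 Su; have iu' := schwartz_L1 (schwartz_derive1 Su).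
have i1 := L1_trig ck k1 xi iu'.
have i2 := L1Z xi (L1_trig ck' k'1 xi iu).
have := @FTC_line _ (fun x => u x * k (x * xi))
  (fun x => (derive1 u) x * k (x * xi) + xi * (u x * k' (x * xi))) 0 0.
rewrite subrr RintegralD// RintegralZl//; last exact: L1_trig.
rewrite -/(trigT k _ _) -/(trigT k' _ _) => h; apply/eqP; rewrite -addr_eq0; apply/eqP.
apply: h.
- move=> x.
  have du := schwartz_is_derive x Su.
  have dx : is_derive x 1 (fun x => k (x * xi)) (xi * k' (x * xi)).
    exact: is_derive_dilation.
  by apply: is_derive_eq; rewrite /GRing.scale/=; ring.
- move=> x; apply: cvgD; [|apply: cvgMr]; apply: cvgM.
  + exact: (schwartz_continuous (schwartz_derive1 Su)).
  + by apply: continuous_comp; [exact: mulrr_continuous|exact: ck].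
  + exact: (schwartz_continuous Su).
  + by apply: continuous_comp; [exact: mulrr_continuous|exact: ck'].
- exact: L1D.
- apply: (@rapid_cvg0 u (fun x => k (x * xi)) (fun n => n%:R) (schwartz_rapid Su)) => // n.
  exact: normr_nat.
- apply: (@rapid_cvg0 u (fun x => k (x * xi)) (fun n => - n%:R) (schwartz_rapid Su)) => // n.
  by rewrite normrN normr_nat.
Qed.

Lemma trigT_is_derive u (xi : R) : S u ->
  is_derive xi 1 (trigT k u) (trigT k' (fun x => x * u x) xi).
Proof.
move=> Su.
have iu := schwartz_L1 Su; have iX := schwartz_L1 (schwartzX Su).
pose f (xi x : R) := u x * k (x * xi).
have df (x y : R) : is_derive x 1 (f ^~ y) (y * u y * k' (y * x)).
  rewrite /f.
  have dx : is_derive x 1 (fun x => k (y * x)) (y * k' (y * x)).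
    rewrite [y * x]mulrC (_ : (fun x => _) = (fun x => k (x * y))).
      exact: is_derive_dilation.
    by apply/funext => z; rewrite mulrC.
  by apply: is_derive_eq; rewrite /GRing.scale/=; ring.
have xiI : `]xi - 1, xi + 1[%classic xi by rewrite /= in_itv/= ltrBlDr !ltrDl ltr01.
have pE (x y : R) : partial1of2 f x y = y * u y * k' (y * x).
  by rewrite partial1of2E; exact: derive_val.
have h1 : forall x, `]xi - 1, xi + 1[%classic x -> L1 (f x).
  by move=> x _; exact: L1_trig.
have h2 : forall x y, `]xi - 1, xi + 1[%classic x -> setT y -> derivable (f ^~ y) x 1.
  by move=> x y _ _; have := df x y => -[].
have h3 : forall x y, `]xi - 1, xi + 1[%classic x -> setT y ->
   `|partial1of2 f x y| <= `|y * u y|.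
  by move=> x y _ _; rewrite pE normrM ler_piMr.
have D := @derivable_under_integral _ _ _ mu f setT measurableT xi _ _ xiI h1 h2
   (fun y => `|y * u y|) (fun y => normr_ge0 _) (L1_norm iX) h3.
have E := @differentiation_under_integral _ _ _ mu f setT measurableT xi _ _ xiI h1 h2
   (fun y => `|y * u y|) (fun y => normr_ge0 _) (L1_norm iX) h3.
apply: DeriveDef; first exact: D.
rewrite -derive1E; apply: (eq_trans E); apply: eq_Rintegral => y _.
exact: pE.
Qed.

End kernel.

Lemma trigTN k u xi : trigT (fun x => - k x) u xi = trigT k (fun x => - u x) xi.
Proof. by apply: eq_Rintegral => x _; rewrite mulrN mulNr. Qed.

Lemma trigTNr k u xi : continuous k -> (forall x, `|k x| <= 1) -> L1 u ->
  trigT k (fun x => - u x) xi = - trigT k u xi.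
Proof.
move=> ck k1 iu; rewrite /trigT -intN; last exact: L1_trig.
by apply: eq_Rintegral => x _; rewrite mulNr.
Qed.

Lemma is_derive_cosN (x : R) : is_derive x 1 cos (- sin x).
Proof. by apply: is_derive_eq. Qed.

Lemma continuous_sinN : continuous (fun x : R => - sin x).
Proof. by move=> x; apply: cvgN; exact: continuous_sin. Qed.

Lemma norm_sinN_le1 (x : R) : `|- sin x| <= 1.
Proof. by rewrite normrN norm_sin_le1. Qed.

(** The class of all cosine and sine transforms of Schwartz functions is stable under
    differentiation (which multiplies [u] by x, up to sign) and under multiplication by the variable
    (which differentiates [u], up to sign). Its members are bounded, so the second stability gives
    rapid decay by induction on the power. *)
Lemma schwartz_trigT u : S u -> S (cosT u) /\ S (sinT u).
Proof.
pose K w := exists2 u, S u & w = cosT u \/ w = sinT u.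
have Kd w : K w -> exists2 w', (forall x : R, is_derive x 1 w (w' x)) & K w'.
  move=> [v Sv [->|->]].
  - exists (sinT (fun x => - (x * v x))).
      move=> x; rewrite -trigTN.
      exact: (trigT_is_derive is_derive_cosN (@norm_cos_le1 R) norm_sinN_le1).
    exists (fun x => - (x * v x)); last by right.
    by apply: schwartzN; exact: schwartzX.
  - exists (cosT (fun x => (x * v x))).
      move=> x; exact: (trigT_is_derive _ (@norm_sin_le1 R) (@norm_cos_le1 R)).
    exists (fun x => (x * v x)); last by left.
    exact: schwartzX.
have Kx w : K w -> K (fun x => x * w x).
  move=> [v Sv [->|->]].
  - exists (fun x => - (derive1 v) x); first by apply: schwartzN; exact: schwartz_derive1.
    right; apply/funext => x.
    have iv := schwartz_L1 (schwartz_derive1 Sv).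
    rewrite (trigTNr _ (@continuous_sin R) (@norm_sin_le1 R) iv).
    by rewrite (trigT_by_parts _ (@continuous_cos R) (@norm_sin_le1 R) (@norm_cos_le1 R))// opprK.
  - exists (derive1 v); first exact: schwartz_derive1.
    left; apply/funext => x.
    rewrite (trigT_by_parts is_derive_cosN continuous_sinN (@norm_cos_le1 R) norm_sinN_le1)//.
    by rewrite trigTN (trigTNr _ (@continuous_sin R) (@norm_sin_le1 R) (schwartz_L1 Sv)) mulrN opprK.
have Kb w : K w -> exists M, forall x, `|w x| <= M.
  by move=> [v Sv [->|->]]; exists (\I (fun x => `|v x|)) => x; apply: trigT_bound => //;
   first [exact: continuous_cos|exact: norm_cos_le1|exact: continuous_sin|exact: norm_sin_le1|exact: schwartz_L1].
have Kr k w : K w -> exists M : R, forall x : R, `|x| ^+ k * `|w x| <= M.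
  elim: k w => [|k IH] w Kw.
    by have [M h] := Kb w Kw; exists M => x; rewrite mul1r.
  have [M h] := IH _ (Kx w Kw); exists M => x.
  by rewrite exprSr -mulrA -normrM.
move=> Su; have KS w : K w -> S w.
  by apply: real_schwartz_coind => {}w Kw; split; [move=> k; exact: Kr|exact: Kd].
by split; apply: KS; exists u => //; [left|right].
Qed.

End schwartz_class.

(** * Uniqueness in the homogeneous Sobolev norm *)

Section weighted_uniqueness.
Variable R : realType.
Implicit Types u v w : R -> R.

Lemma powR_le1D (b r : R) : 0 <= b -> 0 <= r -> r <= 1 -> b `^ r <= 1 + b.
Proof.
move=> b0 r0 r1; have [b1|/ltW b1] := leP b 1.
  rewrite (@le_trans _ _ (1 `^ r)) ?ge0_ler_powR ?nnegrE//.
  by rewrite powR1 lerDl.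
by rewrite (le_trans (ler1_powR b1 r1))// lerDr.
Qed.

(** A ratio c/(a+b) in ]0, 1] is at most its r-th power; adding the cases c = a and c = b, where the
    ratios sum to 1, gives the bound. *)
Lemma powR_subadd (a b r : R) : 0 <= a -> 0 <= b -> 0 < r -> r <= 1 ->
  (a + b) `^ r <= a `^ r + b `^ r.
Proof.
move=> a0 b0 r0 r1; have nr0 : r != 0 by rewrite gt_eqF.
have [->|an0] := eqVneq a 0; first by rewrite powR0// !add0r.
have [->|bn0] := eqVneq b 0; first by rewrite powR0// !addr0.
have ap : 0 < a by rewrite lt_neqAle eq_sym an0.
have bp : 0 < b by rewrite lt_neqAle eq_sym bn0.
have abp : 0 < a + b by rewrite addr_gt0.
have key c : 0 < c -> c <= a + b -> (a + b) `^ r * (c / (a + b)) <= c `^ r.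
  move=> cp cab.
  rewrite [in leRHS](_ : c = (a + b) * (c / (a + b))); last by field; rewrite gt_eqF.
  rewrite powRM; [|exact: ltW|exact: divr_ge0 (ltW cp) (ltW abp)].
  apply: ler_wpM2l; first exact: powR_ge0.
  by apply: ger1_powR => //; rewrite divr_gt0//= ler_pdivrMr// mul1r.
apply: le_trans (lerD (key a ap _) (key b bp _)); rewrite ?lerDl ?lerDr//.
by rewrite -mulrDr -mulrDl divff ?gt_eqF// mulr1.
Qed.

Lemma continuous_powR_norm (r : R) : 0 < r -> continuous (fun x : R => `|x| `^ r).
Proof.
move=> r0 x; have [->|x0] := eqVneq x 0; last first.
  apply: (@continuous_comp _ _ _ (fun x : R => `|x|) (fun y => y `^ r)).
    exact: norm_continuous.
  apply/differentiable_continuous/derivable1_diffP.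
  by apply: derivable_powR; rewrite in_itv/= andbT normr_gt0.
apply/cvgrPdist_lt => e e0; rewrite normr0 powR0 ?gt_eqF//.
(* At 0 the power is not differentiable in general, so continuity is checked by hand with the radius
   e^(1/r). *)
have er : 0 < e `^ r^-1 by rewrite powR_gt0.
exists (e `^ r^-1) => //= y ylt; rewrite sub0r normrN ger0_norm ?powR_ge0//.
rewrite [ltRHS](_ : e = (e `^ r^-1) `^ r); last first.
  by rewrite -powRrM mulVf ?gt_eqF// powRr1// ltW.
apply: gt0_ltr_powR => //; rewrite ?nnegrE ?powR_ge0//.
by move: ylt; rewrite /= sub0r normrN.
Qed.

Lemma is_derive_powR_sqrD (d r x : R) : 0 < d ->
  is_derive x 1 (fun x => (x ^+ 2 + d) `^ r) ((x ^+ 2 + d) `^ (r - 1) * (2 * r * x)).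
Proof.
move=> d0; have b0 : 0 < x ^+ 2 + d by rewrite (lt_le_trans d0)// lerDr sqr_ge0.
have h := @is_derive1_comp _ (fun y => y `^ r) (fun x => x ^+ 2 + d) x
   (r * (x ^+ 2 + d) `^ (r - 1)) (2 * x).
have -> : (x ^+ 2 + d) `^ (r - 1) * (2 * r * x) = r * (x ^+ 2 + d) `^ (r - 1) * (2 * x) by ring.
apply: h; first exact: is_derive1_powR.
by apply: is_derive_eq; rewrite /GRing.scale/=; ring.
Qed.

(** With d > 0 the base stays away from 0. Differentiating (x^2 + d)^q v lowers the exponent to q -
    1 and leaves the polynomial factors on [v], so products with all exponents q <= 1 form a stable
    class. *)
Lemma schwartz_powR_sqrD (d r : R) u : 0 < d -> r <= 1 -> S u ->
  S (fun x => (x ^+ 2 + d) `^ r * u x).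
Proof.
move=> d0 r1 Su.
have bd (x : R) : d <= x ^+ 2 + d by rewrite lerDr sqr_ge0.
have bp (x : R) : 0 < x ^+ 2 + d by exact: lt_le_trans (bd x).
apply: (@real_schwartz_coind _ (fun w => exists2 r, r <= 1 & exists2 v, S v &
  w = (fun x => (x ^+ 2 + d) `^ r * v x))); last by exists r => //; exists u.
move=> _ {r1 Su} [q q1 [v Sv ->]]; split.
  (* The three summands bound (x^2 + d)^q in turn: the base itself when it is at least 1, the
     constant 1 when it is below 1 and q >= 0, and d^q when q < 0. *)
  apply: (@rapid_le _ _ (fun x => (x ^+ 2 + d + (1 + d `^ q)) * v x)).
    have -> : (fun x => (x ^+ 2 + d + (1 + d `^ q)) * v x) =
        (fun x => x * (x * v x) + (d + (1 + d `^ q)) * v x).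
      by apply/funext => x; ring.
    have rv := schwartz_rapid Sv.
    by apply: rapidD; [do 2 apply: rapidX|apply: rapidZ].
  move=> x; rewrite !normrM ler_wpM2r// !ger0_norm ?powR_ge0//; last first.
    by rewrite !addr_ge0 ?sqr_ge0 ?powR_ge0// ltW.
  have [b1|/ltW b1] := leP 1 (x ^+ 2 + d).
    by rewrite (le_trans (ler1_powR b1 q1))// lerDl addr_ge0 ?powR_ge0.
  rewrite (@le_trans _ _ (1 + d `^ q))//; last by rewrite lerDr ltW.
  have [q0|/ltW q0] := leP 0 q.
    apply: (@le_trans _ _ (1 `^ q)); last by rewrite powR1 lerDl powR_ge0.
    by apply: ge0_ler_powR => //; rewrite nnegrE ltW.
  rewrite (@le_trans _ _ (d `^ q)) ?lerDr//.
  rewrite -[q]opprK !(powRN _ (- q)) lef_pV2 ?posrE ?powR_gt0//.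
  by rewrite ge0_ler_powR ?oppr_ge0 ?nnegrE// ltW.
pose v' x := (x ^+ 2 + d) * derive1 v x + 2 * q * (x * v x).
have Sv' : S v'.
  have Sdv := schwartz_derive1 Sv.
  have -> : v' = (fun x => (x * (x * derive1 v x) + d * derive1 v x) + 2 * q * (x * v x)).
    by apply/funext => x; rewrite /v'; ring.
  by apply: schwartzD; [apply: schwartzD; [do 2 apply: schwartzX|apply: schwartzZ]|apply: schwartzZ; exact: schwartzX].
exists (fun x => (x ^+ 2 + d) `^ (q - 1) * v' x).
  move=> x.
  have dv := schwartz_is_derive x Sv; have db := is_derive_powR_sqrD q x d0.
  apply: is_derive_eq; rewrite /GRing.scale/= /v'.
  have E : (x ^+ 2 + d) `^ q = (x ^+ 2 + d) `^ (q - 1) * (x ^+ 2 + d).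
    rewrite -[X in _ = _ * X](powRr1 (ltW (bp x))) -powRD ?subrK//.
    by apply/implyP => _; rewrite gt_eqF.
  by rewrite E; ring.
exists (q - 1); first by rewrite lerBlDr (le_trans q1)// lerDl.
by exists v'.
Qed.

Lemma schwartz_mul_L1 u v : S u -> S v -> L1 (fun x => u x * v x).
Proof.
move=> Su Sv; have [M vM] := schwartz_bounded Sv.
exact: (L1_mul_bounded (schwartz_L1 Su) (L1_measurable (schwartz_L1 Sv)) vM).
Qed.

(** The weight |x|^(2s) is written [(x ^+ 2)]^ s[so as to be the case d = 0 of](x ^+ 2 + d)
    [^ s]. *)
Lemma continuous_powR_sqr (s : R) : 0 < s -> continuous (fun x : R => (x ^+ 2) `^ s).
Proof.
move=> s0.
rewrite (_ : (fun x => _) = (fun x : R => `|x| `^ s * `|x| `^ s)); last first.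
  by apply/funext => x; rewrite -powRM// -expr2 real_normK ?num_real.
by move=> x; apply: cvgM; exact: continuous_powR_norm.
Qed.

Lemma L1_powR_sqr (s : R) u : 0 < s -> s <= 1 -> S u -> L1 (fun x => (x ^+ 2) `^ s * u x ^+ 2).
Proof.
move=> s0 s1 Su; have SXu := schwartzX Su.
have h := L1D (schwartz_mul_L1 Su Su) (schwartz_mul_L1 SXu SXu).
apply: (L1_le _ h) => [|x].
  apply: measurable_funM; first exact: continuous_measurable_fun (continuous_powR_sqr s0).
  exact: measurable_funX (L1_measurable (schwartz_L1 Su)).
rewrite ger0_norm; last by apply: mulr_ge0; [exact: powR_ge0|exact: sqr_ge0].
have -> : u x * u x + x * u x * (x * u x) = (1 + x ^+ 2) * u x ^+ 2 by ring.
apply: ler_wpM2r; first exact: sqr_ge0.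
by apply: powR_le1D => //; [exact: sqr_ge0|exact: ltW].
Qed.

(* The test function is [v = eta * p n] with the smooth multiplier
   [eta = (x ^ 2 + d) ^ s - d ^ s], which lies below [|x| ^ (2 s)] by
   subadditivity of [t ^ s] and tends to it as [d -> 0]. *)
Lemma weighted_weak_limit (s e : R) (p : nat -> R -> R) (n : nat) :
  0 < s -> s <= 1 -> (forall m, S (p m)) ->
  (forall v, S v -> (fun m => \I (fun x => p m x * v x)) @ \oo --> (0 : R)) ->
  (\forall m \near \oo, \I (fun x => (x ^+ 2) `^ s * (p n x - p m x) ^+ 2) <= e) ->
  \I (fun x => (x ^+ 2) `^ s * p n x ^+ 2) <= e.
Proof.
move=> s0 s1 Sp weak cauchy.
pose eta (d x : R) := (x ^+ 2 + d) `^ s - d `^ s.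
have eta0 (d x : R) : 0 < d -> 0 <= eta d x.
  move=> d0; rewrite subr_ge0 ge0_ler_powR ?nnegrE ?(ltW s0) ?(ltW d0)// ?lerDr ?sqr_ge0//.
  by rewrite addr_ge0 ?sqr_ge0// ltW.
have eta_le (d x : R) : 0 < d -> eta d x <= (x ^+ 2) `^ s.
  by move=> d0; rewrite lerBlDr powR_subadd ?sqr_ge0// ltW.
have Sv d : 0 < d -> S (fun x => eta d x * p n x).
  move=> d0; rewrite (_ : (fun x => _) = (fun x => (x ^+ 2 + d) `^ s * p n x - d `^ s * p n x)).
    by apply: schwartzB; [exact: schwartz_powR_sqrD|exact: schwartzZ].
  by apply/funext => x; rewrite mulrBl.
have bound d : 0 < d -> \I (fun x => eta d x * p n x ^+ 2) <= e.
  move=> d0.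
  have E x : eta d x * p n x ^+ 2 = p n x * (eta d x * p n x) by ring.
  have iI : L1 (fun x => eta d x * p n x ^+ 2).
    by apply: L1_ext (schwartz_mul_L1 (Sp n) (Sv d d0)).
  have h : \forall m \near \oo, \I (fun x => eta d x * p n x ^+ 2) <=
      2 * \I (fun x => p m x * (eta d x * p n x)) + e.
    near=> m.
    have im := schwartz_mul_L1 (Sp m) (Sv d d0).
    have iq := L1_powR_sqr s0 s1 (schwartzB (Sp n) (Sp m)).
    have c : \I (fun x => (x ^+ 2) `^ s * (p n x - p m x) ^+ 2) <= e by near: m.
    (* Pointwise this is eta p_n^2 - 2 eta p_n p_m <= eta (p_n - p_m)^2 <= |x|^(2s) (p_n - p_m)^2.
       One copy of the integral of eta p_n^2 cancels; the cross term tends to 0 by weak convergence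
       and the last one is at most [e]. *)
    have : \I (fun x => 2 * (eta d x * p n x ^+ 2)) <= \I (fun x =>
       (2 * (p m x * (eta d x * p n x)) + (x ^+ 2) `^ s * (p n x - p m x) ^+ 2)
          + eta d x * p n x ^+ 2).
      apply: le_Rintegral => //.
      - exact: L1Z.
      - by apply: L1D => //; apply: L1D => //; exact: L1Z.
      - move=> x _; have e0 := eta0 d x d0; have el := eta_le d x d0.
        have := ler_wpM2r (sqr_ge0 (p n x - p m x)) el.
        have := mulr_ge0 e0 (sqr_ge0 (p m x)).
        nra.
    rewrite RintegralZl// RintegralD//; last by apply: L1D => //; exact: L1Z.
    rewrite RintegralD//; last exact: L1Z.
    rewrite RintegralZl//; lra.
  have cv : (fun m => 2 * \I (fun x => p m x * (eta d x * p n x)) + e) @ \oo --> e.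
    rewrite -[X in _ --> X]add0r -[X in X + _](mulr0 2).
    by apply: cvgD; [apply: cvgMr; exact: weak (Sv d d0)|exact: cvg_cst].
  rewrite -(cvg_lim (@Rhausdorff R) cv); apply: limr_ge => //.
  by apply/cvg_ex; exists e.
pose d (k : nat) : R := k.+1%:R^-1.
have d0 k : 0 < d k by rewrite invr_gt0 ltr0n.
have cv : (fun k => \I (fun x => eta (d k) x * p n x ^+ 2)) @ \oo -->
    \I (fun x => (x ^+ 2) `^ s * p n x ^+ 2).
  apply: (@dominated_convergenceR _ setT _ _ (fun x => (x ^+ 2) `^ s * p n x ^+ 2)) => //.
  - move=> k.
    have := L1_measurable (schwartz_mul_L1 (Sp n) (Sv _ (d0 k))).
    by congr measurable_fun; apply/funext => x; ring.
  - move=> x _; apply: cvgMl.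
    have dcv : d @ \oo --> (0 : R) by exact: cvg_harmonic.
    have c0 := continuous_powR_norm s0.
    rewrite -[X in _ --> X]subr0 -[X in _ - X](@powR0 _ s) ?gt_eqF//.
    (* Absolute values are inserted because continuity of the power at 0 is available in the form
       |y|^s. *)
    have -> : (fun k => eta (d k) x) = (fun k => `|x ^+ 2 + d k| `^ s - `|d k| `^ s).
      apply/funext => k; rewrite /eta !ger0_norm//; first exact: ltW.
      by rewrite addr_ge0 ?sqr_ge0// ltW.
    apply: cvgB.
      have xd : (fun k => x ^+ 2 + d k) @ \oo --> x ^+ 2.
        by rewrite -[X in _ --> X]addr0; apply: cvgD => //; exact: cvg_cst.
      have := @cvg_comp _ _ _ _ (fun y => `|y| `^ s) _ _ _ xd (c0 _).
      by rewrite ger0_norm ?sqr_ge0.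
    have := @cvg_comp _ _ _ _ (fun y => `|y| `^ s) _ _ _ dcv (c0 _).
    by rewrite normr0.
  - exact: L1_powR_sqr.
  - move=> k x _; rewrite ger0_norm; last by apply: mulr_ge0; [exact: eta0|exact: sqr_ge0].
    by apply: ler_wpM2r; [exact: sqr_ge0|exact: eta_le].
rewrite -(cvg_lim (@Rhausdorff R) cv); apply: limr_le => //.
  by apply/cvg_ex; eexists; exact: cv.
by near=> k; exact: bound.
Unshelve. all: by end_near. Qed.

End weighted_uniqueness.

(** * The fractional Laplacian of a Schwartz function *)

Section complex_fourier.
Variable R : realType.
Implicit Types (u v : R -> R) (f g h : R -> Cx R).

Lemma int_odd u : L1 u -> (forall x, u (- x) = - u x) -> \I u = 0.
Proof.
move=> iu uo.
have n0 : (-1 : R) != 0 by rewrite oppr_eq0 oner_eq0.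
have := int_affine 0 n0 iu; rewrite normrN1 invr1 mul1r.
under eq_Rintegral => x _ do rewrite mulN1r addr0 uo.
by rewrite intN// => h; lra.
Qed.

Lemma plancherel_L1 u (M : R) : L1 u -> continuous u -> (forall x, `|u x| <= M) ->
  L1 (fun x => cosT u x ^+ 2 + sinT u x ^+ 2).
Proof.
move=> iu cu uM; apply/integrableP; split.
  apply/measurable_EFinP; apply: measurable_funD; apply: measurable_funX.
    exact: (continuous_measurable_fun (trigT_continuous cc c1 iu)).
  exact: (continuous_measurable_fun (trigT_continuous cs s1 iu)).
under eq_integral => x _ do rewrite /= ger0_norm ?addr_ge0 ?sqr_ge0//.
by rewrite (plancherel iu cu uM) ltry.
Qed.

(** Plancherel for the complex function u + iv, whose transform has the two squared expressions as
    real and imaginary parts. The cross term is odd in the frequency, so it integrates to 0. *)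
Lemma plancherel2 u v (M : R) :
  L1 u -> continuous u -> (forall x, `|u x| <= M) ->
  L1 v -> continuous v -> (forall x, `|v x| <= M) ->
  (\int[mu]_x ((cosT u x + sinT v x) ^+ 2 + (cosT v x - sinT u x) ^+ 2)%:E =
   (2 * pi * (\I (fun x => u x ^+ 2) + \I (fun x => v x ^+ 2)))%:E)%E.
Proof.
move=> iu cu uM iv cv vM.
have Lu := plancherel_L1 iu cu uM; have Lv := plancherel_L1 iv cv vM.
have E := L1D Lu Lv.
pose X x := 2 * (cosT u x * sinT v x - cosT v x * sinT u x).
have LX : L1 X.
  apply: (L1_le _ E).
    apply: continuous_measurable_fun => x; apply: cvgMr; apply: cvgB; apply: cvgM.
    - exact: (trigT_continuous cc c1 iu).
    - exact: (trigT_continuous cs s1 iv).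
    - exact: (trigT_continuous cc c1 iv).
    - exact: (trigT_continuous cs s1 iu).
  move=> x; rewrite /X ler_norml.
  have a1 := sqr_ge0 (cosT u x + sinT v x); have a2 := sqr_ge0 (cosT u x - sinT v x).
  have a3 := sqr_ge0 (cosT v x + sinT u x); have a4 := sqr_ge0 (cosT v x - sinT u x).
  by apply/andP; split; nra.
have X0 : \I X = 0.
  apply: int_odd => // x.
  have ev w : cosT w (- x) = cosT w x by apply: eq_Rintegral => y _; rewrite mulrN cosN.
  have od w : L1 w -> sinT w (- x) = - sinT w x.
    move=> iw; rewrite /trigT -intN; last exact: (L1_trig cs s1).
    by apply: eq_Rintegral => y _; rewrite mulrN sinN mulrN.
  by rewrite /X !ev !od//; ring.
transitivity (\int[mu]_x ((cosT u x ^+ 2 + sinT u x ^+ 2 + (cosT v x ^+ 2 + sinT v x ^+ 2)) + X x)%:E)%E.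
  by apply: eq_integral => x _; congr EFin; rewrite /X; ring.
rewrite -EFin_int; last exact: L1D.
congr EFin; rewrite RintegralD// X0 addr0 RintegralD// mulrDr.
by congr (_ + _); rewrite /Rintegral ?(plancherel iu cu uM) ?(plancherel iv cv vM).
Qed.

Lemma ReB (a b : Cx R) : Re (a - b) = Re a - Re b. Proof. by case: a; case: b. Qed.
Lemma ImB (a b : Cx R) : Im (a - b) = Im a - Im b. Proof. by case: a; case: b. Qed.

Definition L2sqr f : \bar R := (\int[mu]_x (Re (f x) ^+ 2 + Im (f x) ^+ 2)%:E)%E.

Lemma cabs_ge0 (z : Cx R) : 0 <= cabs z.
Proof. by rewrite /cabs; case: z => a b /=; exact: sqrtr_ge0. Qed.

Lemma cabs_sqr (z : Cx R) : cabs z ^+ 2 = Re z ^+ 2 + Im z ^+ 2.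
Proof. by case: z => a b; rewrite /cabs /= sqr_sqrtr// addr_ge0 ?sqr_ge0. Qed.

Lemma cLnorm2E f : cLnorm 2 f = (L2sqr f `^ 2^-1)%E.
Proof.
rewrite /cLnorm unlock /L2sqr; congr (_ `^ _)%E; apply: eq_integral => x _ /=.
by rewrite -cabs_sqr ger0_norm ?cabs_ge0// powR_mulrn ?cabs_ge0.
Qed.

Lemma L2sqr_ge0 f : (0 <= L2sqr f)%E.
Proof. by apply: integral_ge0 => x _; rewrite lee_fin addr_ge0 ?sqr_ge0. Qed.

Lemma L2sqrE f : L2sqr f = (cLnorm 2 f `^ 2)%E.
Proof.
rewrite cLnorm2E -poweRrM mulVf// poweRe1//; exact: L2sqr_ge0.
Qed.

Lemma L2sqr_ae_eq f g : cmeasurable f -> cmeasurable g ->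
  L2sqr (fun x => f x - g x) = 0%E -> L2sqr f = L2sqr g.
Proof.
move=> [mfr mfi] [mgr mgi] h.
have mB : measurable_fun setT (fun x => Re (f x - g x) ^+ 2 + Im (f x - g x) ^+ 2).
  under eq_fun do rewrite ReB ImB.
  by apply: measurable_funD; apply: measurable_funX; apply: measurable_funB.
apply: ae_eq_integral => //.
- apply/measurable_EFinP; apply: measurable_funD; exact: measurable_funX.
- apply/measurable_EFinP; apply: measurable_funD; exact: measurable_funX.
- have : (\int[mu]_x `|(Re (f x - g x) ^+ 2 + Im (f x - g x) ^+ 2)%:E| = 0)%E.
    rewrite -[RHS]h; apply: eq_integral => x _.
    by rewrite gee0_abs// lee_fin addr_ge0 ?sqr_ge0.
  move/(ae_eq_integral_abs mu measurableT (proj2 (measurable_EFinP _ _) mB)).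
  apply: filterS => x /= /(_ I) [] /eqP.
  rewrite paddr_eq0 ?sqr_ge0// !sqrf_eq0 ReB ImB !subr_eq0 => /andP[/eqP -> /eqP ->] _.
  by [].
Qed.

(** From |a + b|^2 <= 2|a|^2 + 2|b|^2; working with squared norms avoids taking roots of extended
    reals. *)
Lemma L2sqr_triangle f g h : cmeasurable f -> cmeasurable g -> cmeasurable h ->
  (L2sqr (fun x => f x - h x)%R <= 2%:E * L2sqr (fun x => f x - g x)%R
     + 2%:E * L2sqr (fun x => g x - h x)%R)%E.
Proof.
move=> [mfr mfi] [mgr mgi] [mhr mhi].
have mB f1 f2 : measurable_fun setT (fun x => Re (f1 x)) -> measurable_fun setT (fun x => Im (f1 x)) ->
    measurable_fun setT (fun x => Re (f2 x)) -> measurable_fun setT (fun x => Im (f2 x)) ->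
    measurable_fun setT (fun x => (Re (f1 x - f2 x) ^+ 2 + Im (f1 x - f2 x) ^+ 2)%:E).
  move=> *; apply/measurable_EFinP; under eq_fun do rewrite ReB ImB.
  by apply: measurable_funD; apply: measurable_funX; apply: measurable_funB.
have pos (z : Cx R) : (0 <= (Re z ^+ 2 + Im z ^+ 2)%:E)%E by rewrite lee_fin addr_ge0 ?sqr_ge0.
rewrite /L2sqr -!ge0_integralZl//; [|exact: mB..].
rewrite -ge0_integralD//; last 4 first.
- by move=> x _; rewrite mule_ge0.
- by apply: measurable_funeM; exact: mB.
- by move=> x _; rewrite mule_ge0.
- by apply: measurable_funeM; exact: mB.
apply: ge0_le_integral => //.
- exact: mB.
- by apply: emeasurable_funD; apply: measurable_funeM; exact: mB.
move=> x _; rewrite -!EFinM -EFinD lee_fin !ReB !ImB.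
have := sqr_ge0 ((Re (f x) - Re (g x)) - (Re (g x) - Re (h x))).
have := sqr_ge0 ((Im (f x) - Im (g x)) - (Im (g x) - Im (h x))).
nra.
Qed.

Definition fourier_cst : R := (Num.sqrt (2 * pi))^-1.

Lemma fourier_cst_gt0 : 0 < fourier_cst.
Proof. by rewrite invr_gt0 sqrtr_gt0 mulr_gt0// pi_gt0. Qed.

Lemma fourier_cst_sqr : fourier_cst ^+ 2 * (2 * pi) = 1.
Proof.
have p0 : 0 < 2 * pi :> R by rewrite mulr_gt0// pi_gt0.
by rewrite exprVn sqr_sqrtr ?mulVf ?gt_eqF// ltW.
Qed.

Definition cintegrable f := L1 (fun x => Re (f x)) /\ L1 (fun x => Im (f x)).

(** Real and imaginary parts of the transform before multiplication by 1/sqrt(2 pi). *)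
Definition fourier_re f : R -> R := fun xi => cosT (fun x => Re (f x)) xi + sinT (fun x => Im (f x)) xi.
Definition fourier_im f : R -> R := fun xi => cosT (fun x => Im (f x)) xi - sinT (fun x => Re (f x)) xi.

Lemma Re_fourier f xi : cintegrable f -> Re (fourier f xi) = fourier_cst * fourier_re f xi.
Proof.
move=> [iR iI]; transitivity (fourier_cst * \I (fun x => Re (f x * expi (- (x * xi))))).
  by rewrite /fourier /cintegral /= mul0r subr0.
congr (_ * _); rewrite /fourier_re /trigT -RintegralD//; [|exact: (L1_trig cc c1)|exact: (L1_trig cs s1)].
apply: eq_Rintegral => x _; rewrite /expi cosN sinN; case: (f x) => a b /=.
by rewrite mulrN opprK.
Qed.

Lemma Im_fourier f xi : cintegrable f -> Im (fourier f xi) = fourier_cst * fourier_im f xi.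
Proof.
move=> [iR iI]; transitivity (fourier_cst * \I (fun x => Im (f x * expi (- (x * xi))))).
  by rewrite /fourier /cintegral /= mul0r addr0.
congr (_ * _); rewrite /fourier_im /trigT -RintegralB//; [|exact: (L1_trig cc c1)|exact: (L1_trig cs s1)].
apply: eq_Rintegral => x _; rewrite /expi cosN sinN; case: (f x) => a b /=.
by rewrite mulrN addrC.
Qed.

Lemma Re_inv_fourier g x : cintegrable g -> Re (inv_fourier g x) =
  fourier_cst * (cosT (fun x => Re (g x)) x - sinT (fun x => Im (g x)) x).
Proof.
move=> [iR iI]; transitivity (fourier_cst * \I (fun xi => Re (g xi * expi (x * xi)))).
  by rewrite /inv_fourier /cintegral /= mul0r subr0.
congr (_ * _); rewrite /trigT -RintegralB//; [|exact: (L1_trig cc c1)|exact: (L1_trig cs s1)].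
apply: eq_Rintegral => xi _; rewrite /expi; case: (g xi) => a b /=.
by rewrite [xi * x]mulrC.
Qed.

Lemma Im_inv_fourier g x : cintegrable g -> Im (inv_fourier g x) =
  fourier_cst * (cosT (fun x => Im (g x)) x + sinT (fun x => Re (g x)) x).
Proof.
move=> [iR iI]; transitivity (fourier_cst * \I (fun xi => Im (g xi * expi (x * xi)))).
  by rewrite /inv_fourier /cintegral /= mul0r addr0.
congr (_ * _); rewrite /trigT -RintegralD//; [|exact: (L1_trig cc c1)|exact: (L1_trig cs s1)].
apply: eq_Rintegral => xi _; rewrite /expi; case: (g xi) => a b /=.
by rewrite addrC [xi * x]mulrC.
Qed.

Section lap.
Variable s : R.
Hypotheses (s_gt0 : 0 < s) (s_le1 : s <= 1).

Lemma schwartz_cintegrable f : schwartz f -> cintegrable f.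
Proof. by move=> [Sr Si]; split; exact: schwartz_L1. Qed.

Lemma schwartz_fourier_re f : schwartz f -> S (fourier_re f).
Proof.
move=> [Sr Si]; apply: schwartzD; first by have [] := schwartz_trigT Sr.
by have [] := schwartz_trigT Si.
Qed.

Lemma schwartz_fourier_im f : schwartz f -> S (fourier_im f).
Proof.
move=> [Sr Si]; apply: schwartzB; first by have [] := schwartz_trigT Si.
by have [] := schwartz_trigT Sr.
Qed.

Lemma schwartzCB f g : schwartz f -> schwartz g -> schwartz (fun x => f x - g x).
Proof.
move=> [Sfr Sfi] [Sgr Sgi]; split.
  by under eq_fun do rewrite ReB; exact: schwartzB.
by under eq_fun do rewrite ImB; exact: schwartzB.
Qed.

Lemma fourier_reB f g xi : cintegrable f -> cintegrable g -> fourier_re (fun x => f x - g x) xi = fourier_re f xi - fourier_re g xi.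
Proof.
move=> [fr fi] [gr gi]; rewrite /fourier_re.
under [X in cosT X]eq_fun do rewrite ReB; under [X in sinT X]eq_fun do rewrite ImB.
by rewrite (trigTB cc c1)// (trigTB cs s1)//; ring.
Qed.

Lemma fourier_imB f g xi : cintegrable f -> cintegrable g -> fourier_im (fun x => f x - g x) xi = fourier_im f xi - fourier_im g xi.
Proof.
move=> [fr fi] [gr gi]; rewrite /fourier_im.
under [X in cosT X]eq_fun do rewrite ImB; under [X in sinT X]eq_fun do rewrite ReB.
by rewrite (trigTB cc c1)// (trigTB cs s1)//; ring.
Qed.

Definition lap_symbol f xi : Cx R := ((`|xi| `^ s)%:C)%C * fourier f xi.

Lemma fracLapE f : fracLap_schwartz s f = inv_fourier (lap_symbol f).
Proof. reflexivity. Qed.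

Lemma Re_lap_symbolE f xi : cintegrable f ->
  Re (lap_symbol f xi) = `|xi| `^ s * (fourier_cst * fourier_re f xi).
Proof.
move=> Cf; rewrite -Re_fourier// /lap_symbol.
by case: (fourier f xi) => a b /=; rewrite mul0r subr0.
Qed.

Lemma Re_lap_symbol f : cintegrable f ->
  (fun xi => Re (lap_symbol f xi)) = (fun xi => `|xi| `^ s * (fourier_cst * fourier_re f xi)).
Proof. by move=> Cf; apply/funext => xi; rewrite Re_lap_symbolE. Qed.

Lemma Im_lap_symbolE f xi : cintegrable f ->
  Im (lap_symbol f xi) = `|xi| `^ s * (fourier_cst * fourier_im f xi).
Proof.
move=> Cf; rewrite -Im_fourier// /lap_symbol.
by case: (fourier f xi) => a b /=; rewrite mul0r addr0.
Qed.

Lemma Im_lap_symbol f : cintegrable f ->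
  (fun xi => Im (lap_symbol f xi)) = (fun xi => `|xi| `^ s * (fourier_cst * fourier_im f xi)).
Proof. by move=> Cf; apply/funext => xi; rewrite Im_lap_symbolE. Qed.

(** The product need not be smooth at 0, so only integrability, continuity and boundedness are
    retained: exactly the hypotheses of Plancherel's identity. *)
Lemma schwartz_mul_powR (p : R -> R) : S p ->
  exists M : R, [/\ L1 (fun xi => `|xi| `^ s * p xi), continuous (fun xi => `|xi| `^ s * p xi) &
    forall xi, `| `|xi| `^ s * p xi| <= M].
Proof.
move=> Sp.
have cp : continuous (fun xi => `|xi| `^ s * p xi).
  by move=> x; apply: cvgM; [exact: continuous_powR_norm|exact: schwartz_continuous].
have rp : rapid (fun xi => `|xi| `^ s * p xi).
  move=> k; have [M h] := schwartz_rapid Sp k; have [N h'] := schwartz_rapid Sp k.+1.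
  exists (M + N) => x; rewrite normrM (ger0_norm (powR_ge0 _ _)).
  have := powR_le1D (normr_ge0 x) (ltW s_gt0) s_le1.
  have p0 : 0 <= `|x| ^+ k * `|p x| by rewrite mulr_ge0// exprn_ge0.
  move=> /(ler_wpM2r p0) le; rewrite mulrCA; apply: le_trans le _.
  by rewrite mulrDl mul1r lerD// mulrA -exprS.
have [M h] := rp 0%N.
exists M; split => //; first exact: rapid_L1.
by move=> x; have := h x; rewrite mul1r.
Qed.

Lemma lap_symbol_regular f : schwartz f -> exists M : R,
  [/\ cintegrable (lap_symbol f),
    continuous (fun xi => Re (lap_symbol f xi)), continuous (fun xi => Im (lap_symbol f xi)),
    forall xi, `|Re (lap_symbol f xi)| <= M & forall xi, `|Im (lap_symbol f xi)| <= M].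
Proof.
move=> Sf; have Cf := schwartz_cintegrable Sf.
have [M [i1 i2 i3]] := schwartz_mul_powR (schwartzZ fourier_cst (schwartz_fourier_re Sf)).
have [N [j1 j2 j3]] := schwartz_mul_powR (schwartzZ fourier_cst (schwartz_fourier_im Sf)).
exists (Num.max M N); split.
- by split; [rewrite Re_lap_symbol|rewrite Im_lap_symbol].
- by rewrite Re_lap_symbol.
- by rewrite Im_lap_symbol.
- move=> xi; rewrite (Re_lap_symbolE xi Cf).
  by rewrite le_max i3.
- move=> xi; rewrite (Im_lap_symbolE xi Cf).
  by rewrite le_max j3 orbT.
Qed.

Lemma L2sqr_fracLap_schwartz f : schwartz f -> L2sqr (fracLap_schwartz s f) =
  (fourier_cst ^+ 2 * (\I (fun xi => (xi ^+ 2) `^ s * fourier_re f xi ^+ 2) +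
                       \I (fun xi => (xi ^+ 2) `^ s * fourier_im f xi ^+ 2)))%:E.
Proof.
move=> Sf; have Cf := schwartz_cintegrable Sf.
have [M [[iR iI] cR cI RM IM]] := lap_symbol_regular Sf.
(* The inverse transform has the opposite sign in its exponential; exchanging real and imaginary
   parts of the symbol brings it to the form of [plancherel2]. *)
have E := plancherel2 iI cI IM iR cR RM.
transitivity ((fourier_cst ^+ 2)%:E * (2 * pi * (\I (fun x => Im (lap_symbol f x) ^+ 2) +
   \I (fun x => Re (lap_symbol f x) ^+ 2)))%:E)%E.
  rewrite -E -ge0_integralZl//.
  - apply: eq_integral => x _; rewrite -EFinM; congr EFin.
    rewrite fracLapE Re_inv_fourier// Im_inv_fourier//; ring.
  - apply/measurable_EFinP; apply: measurable_funD; apply: measurable_funX;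
      [apply: measurable_funD|apply: measurable_funB].
    + exact: (continuous_measurable_fun (trigT_continuous cc c1 iI)).
    + exact: (continuous_measurable_fun (trigT_continuous cs s1 iR)).
    + exact: (continuous_measurable_fun (trigT_continuous cc c1 iR)).
    + exact: (continuous_measurable_fun (trigT_continuous cs s1 iI)).
  - by move=> x _; rewrite lee_fin addr_ge0 ?sqr_ge0.
  - by rewrite lee_fin sqr_ge0.
rewrite -EFinM mulrA fourier_cst_sqr mul1r addrC mulrDr; congr EFin; congr (_ + _).
- rewrite -RintegralZl//; last exact: L1_powR_sqr (schwartz_fourier_re Sf).
  apply: eq_Rintegral => xi _; rewrite (Re_lap_symbolE xi Cf).
  by rewrite -[xi ^+ 2]real_normK ?num_real// expr2 powRM//; ring.
- rewrite -RintegralZl//; last exact: L1_powR_sqr (schwartz_fourier_im Sf).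
  apply: eq_Rintegral => xi _; rewrite (Im_lap_symbolE xi Cf).
  by rewrite -[xi ^+ 2]real_normK ?num_real// expr2 powRM//; ring.
Qed.

Notation wre f := (fun xi => `|xi| `^ s * (fourier_cst * fourier_re f xi)).
Notation wim f := (fun xi => `|xi| `^ s * (fourier_cst * fourier_im f xi)).

Lemma Re_fracLap f x : schwartz f ->
  Re (fracLap_schwartz s f x) = fourier_cst * (cosT (wre f) x - sinT (wim f) x).
Proof.
move=> Sf; have Cf := schwartz_cintegrable Sf; have [_ [If _ _ _ _]] := lap_symbol_regular Sf.
by rewrite fracLapE (Re_inv_fourier x If) (Re_lap_symbol Cf) (Im_lap_symbol Cf).
Qed.

Lemma Im_fracLap f x : schwartz f ->
  Im (fracLap_schwartz s f x) = fourier_cst * (cosT (wim f) x + sinT (wre f) x).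
Proof.
move=> Sf; have Cf := schwartz_cintegrable Sf; have [_ [If _ _ _ _]] := lap_symbol_regular Sf.
by rewrite fracLapE (Im_inv_fourier x If) (Im_lap_symbol Cf) (Re_lap_symbol Cf).
Qed.

Lemma L1_weighted_transform f : schwartz f -> L1 (wre f) /\ L1 (wim f).
Proof.
move=> Sf.
have [M [i1 _ _]] := schwartz_mul_powR (schwartzZ fourier_cst (schwartz_fourier_re Sf)).
by have [N [j1 _ _]] := schwartz_mul_powR (schwartzZ fourier_cst (schwartz_fourier_im Sf)).
Qed.

Lemma trigTB_cos_sin u1 u2 v1 v2 (b x : R) : L1 u1 -> L1 u2 -> L1 v1 -> L1 v2 ->
  b * (cosT u1 x - sinT v1 x) - b * (cosT u2 x - sinT v2 x) =
  b * (cosT (fun xi => u1 xi - u2 xi) x - sinT (fun xi => v1 xi - v2 xi) x).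
Proof. by move=> *; rewrite (trigTB cc c1)// (trigTB cs s1)//; ring. Qed.

Lemma trigTB_cosDsin u1 u2 v1 v2 (b x : R) : L1 u1 -> L1 u2 -> L1 v1 -> L1 v2 ->
  b * (cosT v1 x + sinT u1 x) - b * (cosT v2 x + sinT u2 x) =
  b * (cosT (fun xi => v1 xi - v2 xi) x + sinT (fun xi => u1 xi - u2 xi) x).
Proof. by move=> *; rewrite (trigTB cc c1)// (trigTB cs s1)//; ring. Qed.

Lemma fracLapB f g x : schwartz f -> schwartz g ->
  fracLap_schwartz s f x - fracLap_schwartz s g x = fracLap_schwartz s (fun x => f x - g x) x.
Proof.
move=> Sf Sg; have Sh := schwartzCB Sf Sg.
have Cf := schwartz_cintegrable Sf; have Cg := schwartz_cintegrable Sg.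
have [fr fi] := L1_weighted_transform Sf; have [gr gi] := L1_weighted_transform Sg.
have eR : wre (fun x => f x - g x) = (fun xi => wre f xi - wre g xi).
  by apply/funext => xi; rewrite fourier_reB//; ring.
have eI : wim (fun x => f x - g x) = (fun xi => wim f xi - wim g xi).
  by apply/funext => xi; rewrite fourier_imB//; ring.
have ext (a b : Cx R) : Re a = Re b -> Im a = Im b -> a = b.
  by case: a => a1 a2; case: b => b1 b2 /= -> ->.
apply: ext.
  apply: (eq_trans (ReB _ _)).
  apply: (eq_trans (f_equal2 (fun a b => a - b) (Re_fracLap x Sf) (Re_fracLap x Sg))).
  apply: (eq_trans _ (esym (Re_fracLap x Sh))).
  by rewrite eR eI; exact: trigTB_cos_sin.
apply: (eq_trans (ImB _ _)).
apply: (eq_trans (f_equal2 (fun a b => a - b) (Im_fracLap x Sf) (Im_fracLap x Sg))).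
  apply: (eq_trans _ (esym (Im_fracLap x Sh))).
by rewrite eR eI; exact: trigTB_cosDsin.
Qed.

Lemma cmeasurable_fracLap f : schwartz f -> cmeasurable (fracLap_schwartz s f).
Proof.
move=> Sf.
have [fr fi] := L1_weighted_transform Sf; split.
  under eq_fun do rewrite Re_fracLap//.
  apply: measurable_funM => //; apply: measurable_funB.
    exact: (continuous_measurable_fun (trigT_continuous cc c1 fr)).
  exact: (continuous_measurable_fun (trigT_continuous cs s1 fi)).
under eq_fun do rewrite Im_fracLap//.
apply: measurable_funM => //; apply: measurable_funD.
  exact: (continuous_measurable_fun (trigT_continuous cc c1 fi)).
exact: (continuous_measurable_fun (trigT_continuous cs s1 fr)).
Qed.

End lap.
End complex_fourier.

(** * Independence of the approximating sequence *)

Section fracLap_uniqueness.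
Variable R : realType.
Implicit Types (u v : R -> R) (f g h : R -> Cx R).

Lemma norm_Re_le (z : Cx R) : `|Re z| <= cabs z.
Proof.
rewrite -(ler_pXn2r (n := 2))// ?nnegrE ?cabs_ge0//.
by rewrite cabs_sqr real_normK ?num_real// lerDl sqr_ge0.
Qed.

Lemma norm_Im_le (z : Cx R) : `|Im z| <= cabs z.
Proof.
rewrite -(ler_pXn2r (n := 2))// ?nnegrE ?cabs_ge0//.
by rewrite cabs_sqr real_normK ?num_real// lerDr sqr_ge0.
Qed.

Lemma cvgC_norm (z : nat -> Cx R) (l : Cx R) : z @ \oo --> l ->
  forall e : R, 0 < e -> \forall n \near \oo, cabs (l - z n) < e.
Proof.
move=> /cvgrPdist_lt h e e0.
have e0' : 0 < (e%:C)%C :> Cx R by rewrite ltcR.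
have := h _ e0'; apply: filterS => n.
by rewrite /cabs -[`|_|]/((ComplexField.Normc.normc _)%:C)%C ltcR.
Qed.

Lemma cvg_ReIm (z : nat -> Cx R) (l : Cx R) : z @ \oo --> l ->
  (fun n => Re (z n)) @ \oo --> Re l /\ (fun n => Im (z n)) @ \oo --> Im l.
Proof.
move=> /cvgC_norm h; split; apply/cvgrPdist_lt => e e0; have := h e e0; apply: filterS => n.
- by apply: le_lt_trans; rewrite -ReB; exact: norm_Re_le.
- by apply: le_lt_trans; rewrite -ImB; exact: norm_Im_le.
Qed.

(** A real test function separates real and imaginary parts. *)
Lemma cvg_tempered_real (fn : nat -> R -> Cx R) f v : cvg_tempered fn (distr_of f) -> S v ->
  (fun n => \I (fun x => Re (fn n x) * v x)) @ \oo --> \I (fun x => Re (f x) * v x) /\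
  (fun n => \I (fun x => Im (fn n x) * v x)) @ \oo --> \I (fun x => Im (f x) * v x).
Proof.
move=> cv Sv.
have S0 : S (fun _ : R => 0 : R).
  by have := schwartzZ 0 Sv; congr real_schwartz; apply/funext => x; rewrite mul0r.
have Sphi : schwartz (fun x => ((v x)%:C)%C) by split.
have [] := cvg_ReIm (cv _ Sphi).
have E h : Re (distr_of h (fun x => ((v x)%:C)%C)) = \I (fun x => Re (h x) * v x).
  rewrite /distr_of /cintegral /=; apply: eq_Rintegral => x _.
  by case: (h x) => a b /=; rewrite mulr0 subr0.
have E' h : Im (distr_of h (fun x => ((v x)%:C)%C)) = \I (fun x => Im (h x) * v x).
  rewrite /distr_of /cintegral /=; apply: eq_Rintegral => x _.
  by case: (h x) => a b /=; rewrite mulr0 add0r.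
under eq_fun do rewrite E.
under [X in _ -> X @ _ --> _ -> _]eq_fun do rewrite E'.
by rewrite E E'.
Qed.

Lemma L2sqr_lt f (e : R) : 0 < e -> (cLnorm 2 f < e%:E)%E -> (L2sqr f < (e ^+ 2)%:E)%E.
Proof.
move=> e0; rewrite L2sqrE.
have : (0 <= cLnorm 2 f)%E by exact: Lnorm_ge0.
case: (cLnorm 2 f) => [r| |]//; rewrite lee_fin => r0; rewrite lte_fin => re.
by rewrite poweR_EFin lte_fin powR_mulrn// ltrXn2r.
Qed.

Section main.
Variable s : R.
Hypotheses (s_gt0 : 0 < s) (s_le1 : s <= 1).

(** The transform is moved onto the test function by [trigT_swap]; tempered convergence is then
    applied to [cosT v] and [sinT v], which are again Schwartz. *)
Lemma fourier_re_weak (fn : nat -> R -> Cx R) f v : (forall n, schwartz (fn n)) -> schwartz f ->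
  cvg_tempered fn (distr_of f) -> S v ->
  (fun n => \I (fun x => fourier_re (fun x => f x - fn n x) x * v x)) @ \oo --> (0 : R).
Proof.
move=> Sfn Sf cv Sv; have [Scv Ssv] := schwartz_trigT Sv; have iv := schwartz_L1 Sv.
have [Sfr Sfi] := Sf.
have [cr _] := cvg_tempered_real cv Scv; have [_ ci] := cvg_tempered_real cv Ssv.
have E n : \I (fun x => fourier_re (fun x => f x - fn n x) x * v x) =
    (\I (fun x => Re (f x) * cosT v x) - \I (fun x => Re (fn n x) * cosT v x)) +
    (\I (fun x => Im (f x) * sinT v x) - \I (fun x => Im (fn n x) * sinT v x)).
  have [Snr Sni] := Sfn n.
  have [Skr Ski] := schwartzCB Sf (Sfn n).
  rewrite -!RintegralB//; [|exact: schwartz_mul_L1..].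
  transitivity (\I (fun x => Re (f x - fn n x) * cosT v x) + \I (fun x => Im (f x - fn n x) * sinT v x)).
    rewrite -(trigT_swap cc c1 (schwartz_L1 Skr) iv) -(trigT_swap cs s1 (schwartz_L1 Ski) iv).
    have [Sckr _] := schwartz_trigT Skr; have [_ Sski] := schwartz_trigT Ski.
    rewrite -RintegralD//; [|exact: schwartz_mul_L1..].
    by apply: eq_Rintegral => x _; rewrite /fourier_re; ring.
  by congr (_ + _); apply: eq_Rintegral => x _; rewrite (ReB, ImB) mulrBl.
have subrr2 (a b : R) : (a - a) + (b - b) = 0 by lra.
rewrite (funext E) -(subrr2 (\I (fun x => Re (f x) * cosT v x))
  (\I (fun x => Im (f x) * sinT v x))).
apply: (cvgD (cvgB (cvg_cst _) cr) (cvgB (cvg_cst _) ci)).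
Qed.

Lemma fourier_im_weak (fn : nat -> R -> Cx R) f v : (forall n, schwartz (fn n)) -> schwartz f ->
  cvg_tempered fn (distr_of f) -> S v ->
  (fun n => \I (fun x => fourier_im (fun x => f x - fn n x) x * v x)) @ \oo --> (0 : R).
Proof.
move=> Sfn Sf cv Sv; have [Scv Ssv] := schwartz_trigT Sv; have iv := schwartz_L1 Sv.
have [Sfr Sfi] := Sf.
have [_ ci] := cvg_tempered_real cv Scv; have [cr _] := cvg_tempered_real cv Ssv.
have E n : \I (fun x => fourier_im (fun x => f x - fn n x) x * v x) =
    (\I (fun x => Im (f x) * cosT v x) - \I (fun x => Im (fn n x) * cosT v x)) -
    (\I (fun x => Re (f x) * sinT v x) - \I (fun x => Re (fn n x) * sinT v x)).
  have [Snr Sni] := Sfn n.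
  have [Skr Ski] := schwartzCB Sf (Sfn n).
  rewrite -[X in _ = X - _]RintegralB//; [|exact: schwartz_mul_L1..].
  rewrite -[X in _ = _ - X]RintegralB//; [|exact: schwartz_mul_L1..].
  transitivity (\I (fun x => Im (f x - fn n x) * cosT v x) - \I (fun x => Re (f x - fn n x) * sinT v x)).
    rewrite -(trigT_swap cs s1 (schwartz_L1 Skr) iv) -(trigT_swap cc c1 (schwartz_L1 Ski) iv).
    have [_ Sskr] := schwartz_trigT Skr; have [Scki _] := schwartz_trigT Ski.
    rewrite -RintegralB//; [|exact: schwartz_mul_L1..].
    by apply: eq_Rintegral => x _; rewrite /fourier_im; ring.
  by congr (_ - _); apply: eq_Rintegral => x _; rewrite (ReB, ImB) mulrBl.
have subrr2 (a b : R) : (a - a) - (b - b) = 0 by lra.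
rewrite (funext E) -(subrr2 (\I (fun x => Im (f x) * cosT v x))
  (\I (fun x => Re (f x) * sinT v x))).
apply: (cvgB (cvgB (cvg_cst _) ci) (cvgB (cvg_cst _) cr)).
Qed.

(** An arbitrary approximating sequence [fn] is compared with the constant sequence [f]. The
    differences f - fn n tend to 0 in S' and have Cauchy weighted transforms, so their fractional
    Laplacians tend to 0 in L^2. Those of [fn] therefore converge both to [g] and to that of [f],
    and the two limits agree almost everywhere. *)
Lemma is_fracLap_unique f g : schwartz f -> is_fracLap s (distr_of f) g ->
  L2sqr g = L2sqr (fracLap_schwartz s f).
Proof.
move=> Sf [fn [[Sfn cvfn Cfn] [[mg _] cvg]]].
pose k n x := f x - fn n x.
have Sk n : schwartz (k n) by exact: schwartzCB.
pose A n := \I (fun xi => (xi ^+ 2) `^ s * fourier_re (k n) xi ^+ 2).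
pose B n := \I (fun xi => (xi ^+ 2) `^ s * fourier_im (k n) xi ^+ 2).
have c20 : 0 < fourier_cst R ^+ 2 by rewrite exprn_gt0// fourier_cst_gt0.
have sqk n : L2sqr (fun x => fracLap_schwartz s f x - fracLap_schwartz s (fn n) x) =
    (fourier_cst R ^+ 2 * (A n + B n))%:E.
  rewrite (_ : (fun x => _) = fracLap_schwartz s (k n)); first exact: L2sqr_fracLap_schwartz.
  by apply/funext => x; exact: fracLapB.
have AB (e : R) : 0 < e -> \forall n \near \oo, A n <= e ^+ 2 / fourier_cst R ^+ 2 /\
     B n <= e ^+ 2 / fourier_cst R ^+ 2.
  move=> e0; have [N HN] := Cfn e e0.
  near=> n.
  (* Since k n - k m = fn m - fn n, the Cauchy property of the fractional Laplacians of [fn] is one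
     for the weighted transforms of [k]. *)
  have cauchy m : (N <= m)%N ->
      \I (fun xi => (xi ^+ 2) `^ s * (fourier_re (k n) xi - fourier_re (k m) xi) ^+ 2) +
      \I (fun xi => (xi ^+ 2) `^ s * (fourier_im (k n) xi - fourier_im (k m) xi) ^+ 2)
       <= e ^+ 2 / fourier_cst R ^+ 2.
    move=> Nm; have Nn : (N <= n)%N by near: n; exact: nbhs_infty_ge.
    have := L2sqr_lt e0 (HN m n Nm Nn).
    rewrite (_ : (fun x => _) = fracLap_schwartz s (fun x => fn m x - fn n x)); last first.
      by apply/funext => x; exact: fracLapB.
    have Smn := schwartzCB (Sfn m) (Sfn n).
    rewrite L2sqr_fracLap_schwartz// lte_fin => /ltW; rewrite ler_pdivlMr// mulrC.
    apply: le_trans; rewrite le_eqVlt; apply/orP; left; apply/eqP.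
    have Cf := schwartz_cintegrable Sf; have Cn := schwartz_cintegrable (Sfn n); have Cm := schwartz_cintegrable (Sfn m).
    congr ((_ + _) * _); apply: eq_Rintegral => xi _; congr (_ * _).
      by rewrite /k !fourier_reB//; ring.
    by rewrite /k !fourier_imB//; ring.
  have pos (w : R -> R) : 0 <= \I (fun xi => (xi ^+ 2) `^ s * w xi ^+ 2).
    by apply: Rintegral_ge0 => x _; rewrite mulr_ge0 ?powR_ge0 ?sqr_ge0.
  split.
  - apply: (@weighted_weak_limit _ s _ (fun n => fourier_re (k n))) => //.
    + by move=> m; exact: schwartz_fourier_re.
    + by move=> v Sv; exact: fourier_re_weak.
    + near=> m; have Nm : (N <= m)%N by near: m; exact: nbhs_infty_ge.
      by apply: le_trans (cauchy m Nm); rewrite lerDl; exact: (pos (fun xi => _ - _)).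
  - apply: (@weighted_weak_limit _ s _ (fun n => fourier_im (k n))) => //.
    + by move=> m; exact: schwartz_fourier_im.
    + by move=> v Sv; exact: fourier_im_weak.
    + near=> m; have Nm : (N <= m)%N by near: m; exact: nbhs_infty_ge.
      by apply: le_trans (cauchy m Nm); rewrite lerDr; exact: (pos (fun xi => _ - _)).
(* The factor 6 is 2 * 2 + 2 * 1: the triangle inequality doubles both terms, the first being at
   most 2 e^2 (e^2 from each of [A n] and [B n]) and the second at most e^2. *)
have small (e : R) : 0 < e ->
   (L2sqr (fun x => fracLap_schwartz s f x - g x)%R <= (6 * e ^+ 2)%:E)%E.
  move=> e0.
  have h : \forall n \near \oo, (cLnorm 2 (fun x => fracLap_schwartz s (fn n) x - g x)%R < e%:E)%E.
    apply: (cvg [set y | (y < e%:E)%E]); apply: open_nbhs_nbhs.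
    by split; [exact: open_ereal_lt_ereal|rewrite /= lte_fin].
  near \oo => n.
  have [An Bn] : A n <= e ^+ 2 / fourier_cst R ^+ 2 /\ B n <= e ^+ 2 / fourier_cst R ^+ 2.
    by near: n; exact: AB.
  have gn : (cLnorm 2 (fun x => fracLap_schwartz s (fn n) x - g x)%R < e%:E)%E by near: n.
  have tri := L2sqr_triangle (cmeasurable_fracLap s_gt0 s_le1 Sf)
    (cmeasurable_fracLap s_gt0 s_le1 (Sfn n)) mg.
  apply: (le_trans tri); rewrite sqk.
  apply: (@le_trans _ _ (2%:E * (2 * e ^+ 2)%:E + 2%:E * (e ^+ 2)%:E)%E).
    apply: leeD; apply: lee_wpmul2l => //; last exact/ltW/L2sqr_lt.
    rewrite lee_fin mulrDr; move: An Bn; rewrite !ler_pdivlMr//; lra.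
  by rewrite -!EFinM -EFinD lee_fin; lra.
have z : L2sqr (fun x => fracLap_schwartz s f x - g x) = 0%E.
  apply/eqP; rewrite eq_le L2sqr_ge0 andbT; apply/lee_addgt0Pr => e e0; rewrite add0e.
  have q0 : 0 < Num.sqrt (e / 6) by rewrite sqrtr_gt0 divr_gt0.
  have e6 : 0 <= e / 6 by apply: divr_ge0 => //; exact: ltW.
  apply: (le_trans (small _ q0)); rewrite (sqr_sqrtr e6) lee_fin.
  by rewrite mulrCA divff ?mulr1.
by apply/esym/L2sqr_ae_eq => //; exact: cmeasurable_fracLap.
Unshelve. all: by end_near. Qed.

(** The constant sequence [f] shows that a limit exists, so [xget] returns a genuine one and not its
    default value 0. *)
Lemma is_fracLap_fracLap f : schwartz f -> is_fracLap s (distr_of f) (fracLap s (distr_of f)).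
Proof.
move=> Sf; rewrite /fracLap.
have : exists g, is_fracLap s (distr_of f) g.
  exists (fracLap_schwartz s f), (fun=> f).
  have z : cLnorm 2 (fun x => fracLap_schwartz s f x - fracLap_schwartz s f x) = 0%E.
    rewrite cLnorm2E (_ : L2sqr _ = 0%E) ?poweR0r//.
    by apply: integral0_eq => x _; rewrite ReB ImB !subrr expr0n /= addr0.
  split; [split => //|split].
  - by move=> phi _; exact: cvg_cst.
  - by move=> e e0; exists 0%N => m n _ _; rewrite z lte_fin.
  - split; first exact: cmeasurable_fracLap.
    by rewrite cLnorm2E L2sqr_fracLap_schwartz// poweR_lty// ltry.
  - by under eq_fun do rewrite z; exact: cvg_cst.
exact: (@xgetPex _ (fun=> 0) [set g | is_fracLap s (distr_of f) g]).
Qed.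

Lemma schwartz_fracLap_finite f : schwartz f -> fracLap_finite s (distr_of f).
Proof. by move=> /is_fracLap_fracLap [fn [h _]]; exists fn. Qed.

Lemma L2sqr_fracLap f : schwartz f -> L2sqr (fracLap s (distr_of f)) =
  (fourier_cst R ^+ 2 * (\I (fun xi => (xi ^+ 2) `^ s * fourier_re f xi ^+ 2) +
                       \I (fun xi => (xi ^+ 2) `^ s * fourier_im f xi ^+ 2)))%:E.
Proof.
move=> Sf; rewrite (is_fracLap_unique Sf (is_fracLap_fracLap Sf)); exact: L2sqr_fracLap_schwartz.
Qed.

End main.
End fracLap_uniqueness.

(** * Smooth bumps *)

Section bump.
Variable R : realType.
Implicit Types (u v : R -> R).

(** The powers of 1/x are included because derivatives of e^(-1/x) produce them: the span of the
    family is stable under differentiation. *)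
Definition flat (j : nat) (x : R) : R :=
  if 0 < x then x^-1 ^+ j * expR (- x^-1) else 0.

Lemma exprn_le_expR (n : nat) (t : R) : 0 <= t -> t ^+ n <= n`!%:R * expR t.
Proof.
case: n => [|n] t0.
  by rewrite expr0 fact0 mul1r (le_trans _ (expR_ge1Dx t))// lerDl.
rewrite mulrC -ler_pdivrMr ?ltr0n ?fact_gt0//.
by apply: le_trans (expR_ge1Dxn n t0); rewrite lerDr.
Qed.

Lemma flat_ge0 j x : 0 <= flat j x.
Proof.
rewrite /flat; case: ifP => // x0; rewrite mulr_ge0 ?expR_ge0// exprn_ge0// invr_ge0.
exact: ltW.
Qed.

Lemma flat_le0 j x : x <= 0 -> flat j x = 0.
Proof. by rewrite /flat ltNge => ->. Qed.

Lemma flat_bound j x : flat j x <= j`!%:R.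
Proof.
rewrite /flat; case: ifP => // x0.
by rewrite expRN ler_pdivrMr ?expR_gt0// exprn_le_expR// invr_ge0 ltW.
Qed.

(** Trading two powers of 1/x for x^2 in [flat_bound] gives quadratic vanishing at 0, whence a zero
    derivative there. *)
Lemma flat_flat j x : flat j x <= j.+2`!%:R * x ^+ 2.
Proof.
rewrite {1}/flat; case: ifP => // x0; last by rewrite mulr_ge0 ?sqr_ge0.
have := flat_bound j.+2 x; rewrite /flat x0 => h.
have -> : x^-1 ^+ j * expR (- x^-1) = x^-1 ^+ j.+2 * expR (- x^-1) * x ^+ 2.
  by rewrite -addn2 exprD; field; rewrite gt_eqF.
by apply: ler_wpM2r => //; exact: sqr_ge0.
Qed.

Lemma flat_is_derive j (x : R) : is_derive x 1 (flat j) (flat j.+2 x - j%:R * flat j.+1 x).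
Proof.
have [x0|x0|x0] := ltgtP x 0.
- have -> : flat j.+2 x - j%:R * flat j.+1 x = 0 by rewrite !flat_le0 ?(ltW x0)// mulr0 subr0.
  apply: (near_eq_is_derive _ (is_derive_cst (0 : R) x 1)).
  by near=> y; rewrite /flat ifF//; apply/negbTE; rewrite -leNgt ltW//; near: y; exact: lt_nbhsl.
- pose f (y : R) := y^-1 ^+ j * expR (- y^-1).
  have ne : \forall y \near x, f y = flat j y.
    by near=> y; rewrite /f /flat ifT//; near: y; exact: lt_nbhsr.
  have xn0 : x != 0 by rewrite gt_eqF.
  have dV : is_derive x 1 (fun y : R => y^-1) (- (x^-1 ^+ 2)).
    apply: is_derive_eq; first exact: is_deriveV.
    by rewrite /GRing.scale/= mulr1 exprVn.
  apply: (near_eq_is_derive ne); rewrite /flat x0 /f; case: (j) => [|n].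
    under eq_fun do rewrite expr0.
    by apply: is_derive_eq; rewrite /GRing.scale/=; ring.
  have dX : is_derive x 1 (fun y : R => y^-1 ^+ n.+1) (n.+1%:R * x^-1 ^+ n * - (x^-1 ^+ 2)).
    apply: (@is_derive1_comp _ (fun t : R => t ^+ n.+1) (fun y => y^-1) x) => //.
    have := @is_deriveX _ _ (@id R) n.+1 x^-1 1 1 (is_derive_id _ _).
    by rewrite /GRing.scale/= mulr1 exprfctE.
  by apply: is_derive_eq; rewrite /GRing.scale/= !exprS -natr1; ring.
- rewrite x0 (_ : flat j.+2 0 - _ = 0); last by rewrite !flat_le0// mulr0 subr0.
  (* By [flat_flat] the difference quotient is at most a constant times |h|. *)
  have cv : (fun h : R => h^-1 *: (flat j (h *: 1 + 0) - flat j 0)) @ 0^' --> (0 : R).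
    apply/cvgrPdist_le => e e0.
    have C0 : 0 < j.+2`!%:R :> R by rewrite ltr0n fact_gt0.
    near=> h; have hn0 : h != 0 by near: h; exact: nbhs_dnbhs_neq.
    have hh : `|h| < e / j.+2`!%:R.
      by near: h; apply: dnbhs0_lt; rewrite divr_gt0.
    rewrite sub0r normrN addr0 /GRing.scale/= mulr1 {2}/flat ltxx subr0 normrM normfV.
    rewrite (ger0_norm (flat_ge0 _ _)) mulrC ler_pdivrMr ?normr_gt0//.
    apply: (le_trans (flat_flat j h)); rewrite -real_normK ?num_real// expr2 mulrA.
    by rewrite ler_wpM2r// mulrC -ler_pdivlMr// ltW.
  apply: DeriveDef; first by apply/cvg_ex; exists 0.
  by rewrite /derive; apply/cvg_lim.
Unshelve. all: by end_near. Qed.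

Definition bump (p q x : R) : R := flat 0 (x - p) * flat 0 (q - x).

(** A class containing the bump and stable under differentiation, as required by
    [real_schwartz_coind]. *)
Inductive bump_span (p q : R) : (R -> R) -> Prop :=
| bump_span_base a i j : bump_span p q (fun x => a * (flat i (x - p) * flat j (q - x)))
| bump_span_add u v : bump_span p q u -> bump_span p q v -> bump_span p q (fun x => u x + v x).

Lemma schwartz_bump p q : S (bump p q).
Proof.
apply: (@real_schwartz_coind _ (bump_span p q)); last first.
  have := bump_span_base p q 1 0 0; congr bump_span; apply/funext => x.
  by rewrite mul1r.
move=> w0; elim=> {w0} [a i j|u v Ku [ru [u' du Ku']] Kv [rv [v' dv Kv']]]; last first.
  split; first exact: rapidD.
  exists (fun x => u' x + v' x); last exact: bump_span_add.
  by move=> x; have := du x; have := dv x => *; exact: is_deriveD.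
split.
  (* On the support p < x < q one has |x| <= |p| + |q|, and [flat_bound] gives the factorials. *)
  apply: rapidZ => k; exists ((`|p| + `|q|) ^+ k * (i`!%:R * j`!%:R)) => x.
  rewrite (ger0_norm (mulr_ge0 (flat_ge0 _ _) (flat_ge0 _ _))).
  have B0 : 0 <= (`|p| + `|q|) ^+ k * (i`!%:R * j`!%:R).
    by rewrite !mulr_ge0 ?exprn_ge0 ?addr_ge0.
  have [px|xp] := ltP 0 (x - p); last by rewrite flat_le0// mul0r mulr0.
  have [xq|qx] := ltP 0 (q - x); last by rewrite (flat_le0 _ qx) !mulr0.
  apply: ler_pM; rewrite ?exprn_ge0 ?mulr_ge0 ?flat_ge0//; last first.
    by apply: ler_pM; rewrite ?flat_ge0 ?flat_bound.
  rewrite lerXn2r ?nnegrE ?addr_ge0// ler_norml.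
  have := ler_norm q; have := ler_norm (- p); rewrite normrN.
  have := normr_ge0 p; have := normr_ge0 q.
  by move=> *; apply/andP; split; lra.
pose w (x : R) := (a * (flat i.+2 (x - p) * flat j (q - x)) +
      (- a * i%:R) * (flat i.+1 (x - p) * flat j (q - x))) +
     ((- a) * (flat i (x - p) * flat j.+2 (q - x)) +
      (a * j%:R) * (flat i (x - p) * flat j.+1 (q - x))).
exists w; last by do 2 apply: bump_span_add; exact: bump_span_base.
move=> x.
have d1 : is_derive x 1 (fun x => flat i (x - p)) (flat i.+2 (x - p) - i%:R * flat i.+1 (x - p)).
  rewrite -[X in is_derive _ _ _ X]mulr1.
  apply: (@is_derive1_comp _ (flat i) (fun x => x - p)); first exact: flat_is_derive.
  by apply: is_derive_eq; rewrite subr0.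
have d2 : is_derive x 1 (fun x => flat j (q - x)) ((flat j.+2 (q - x) - j%:R * flat j.+1 (q - x)) * (-1)).
  apply: (@is_derive1_comp _ (flat j) (fun x => q - x)); first exact: flat_is_derive.
  by apply: is_derive_eq; rewrite ?/GRing.scale ?/=; ring.
apply: is_derive_eq; rewrite /GRing.scale/= /w; ring.
Qed.

Lemma bump_eq0 p q x : ~~ (p < x < q) -> bump p q x = 0.
Proof.
rewrite negb_and -!leNgt => /orP[xp|qx]; rewrite /bump.
  by rewrite flat_le0 ?subr_le0// mul0r.
by rewrite [X in _ * X]flat_le0 ?subr_le0// mulr0.
Qed.

Lemma bump_shift p q t x : bump (p + t) (q + t) (x + t) = bump p q x.
Proof. by rewrite /bump; congr (flat _ _ * flat _ _); ring. Qed.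

(** A vanishing integral would put []p, q[], where the bump does not vanish, inside a null set. *)
Lemma int_bump_sqr_gt0 p q : p < q -> 0 < \I (fun x => bump p q x ^+ 2).
Proof.
move=> pq.
have cb := schwartz_continuous (schwartz_bump p q).
have i2 := schwartz_mul_L1 (schwartz_bump p q) (schwartz_bump p q).
rewrite lt_neqAle Rintegral_ge0 ?andbT => [|x _]; last exact: sqr_ge0.
apply/negP => /eqP z.
have h : (\int[mu]_x `|(bump p q x ^+ 2)%:E| = 0)%E.
  under eq_integral do rewrite gee0_abs ?lee_fin ?sqr_ge0//.
  by rewrite -EFin_int -?z.
have mb : measurable_fun setT (fun x => (bump p q x ^+ 2)%:E).
  by apply/measurable_EFinP/measurable_funX; exact: continuous_measurable_fun.
have [N [mN N0 sub]] := (ae_eq_integral_abs mu measurableT mb).1 h.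
have : (mu `]p, q[ <= mu N)%E.
  apply: le_measure; rewrite ?inE//.
  move=> x /=; rewrite in_itv/= => /andP[px xq]; apply: sub => /= /(_ I) [] /eqP.
  rewrite sqrf_eq0 mulf_eq0 /flat !subr_gt0 px xq.
  by rewrite !mulf_eq0 !expr0 !oner_eq0 !gt_eqF ?expR_gt0.
by rewrite N0 lebesgue_measure_itv/= lte_fin pq -EFinD lee_fin subr_le0 leNgt pq.
Qed.

(* The Plancherel identity makes [cosT (cosT u) + sinT (sinT u) - 2 pi u] and
   [cosT (sinT u) - sinT (cosT u)] orthogonal to themselves. *)
Lemma fourier_inversion_L2 u : S u ->
  \I (fun x => (cosT (cosT u) x + sinT (sinT u) x - 2 * pi * u x) ^+ 2 +
                (cosT (sinT u) x - sinT (cosT u) x) ^+ 2) = 0.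
Proof.
move=> Su; have [Sc Ss] := schwartz_trigT Su.
have [Scc Ssc] := schwartz_trigT Sc; have [Scs Sss] := schwartz_trigT Ss.
have [Mu uM] := schwartz_bounded Su; have [Mc cM] := schwartz_bounded Sc.
have [Ms sM] := schwartz_bounded Ss.
pose A x := cosT (cosT u) x + sinT (sinT u) x.
pose B x := cosT (sinT u) x - sinT (cosT u) x.
have SA : S A by exact: schwartzD.
have SB : S B by exact: schwartzB.
have iu := schwartz_L1 Su; have ic := schwartz_L1 Sc; have isi := schwartz_L1 Ss.
have I2 v : S v -> L1 (fun x => v x ^+ 2).
  by move=> Sv; apply: L1_ext (schwartz_mul_L1 Sv Sv) => x; rewrite expr2.
have P1 : \I (fun x => cosT u x ^+ 2) + \I (fun x => sinT u x ^+ 2) = 2 * pi * \I (fun x => u x ^+ 2).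
  rewrite -RintegralD//; [|exact: I2..].
  by rewrite /Rintegral (plancherel iu (schwartz_continuous Su) uM).
have P2 : \I (fun x => A x ^+ 2 + B x ^+ 2) = (2 * pi) ^+ 2 * \I (fun x => u x ^+ 2).
  rewrite expr2 -mulrA -P1 [LHS]/Rintegral.
  have h1 x : `|cosT u x| <= Num.max Mc Ms by rewrite le_max cM.
  have h2 x : `|sinT u x| <= Num.max Mc Ms by rewrite le_max sM orbT.
  by rewrite (plancherel2 ic (schwartz_continuous Sc) h1 isi (schwartz_continuous Ss) h2).
have P3 : \I (fun x => A x * u x) = 2 * pi * \I (fun x => u x ^+ 2).
  rewrite -P1.
  have E1 : \I (fun x => u x * cosT (cosT u) x) = \I (fun x => cosT u x ^+ 2).
    rewrite (trigT_swap (@continuous_cos R) (@norm_cos_le1 R) ic iu).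
    by apply: eq_Rintegral => x _; rewrite expr2.
  have E2 : \I (fun x => u x * sinT (sinT u) x) = \I (fun x => sinT u x ^+ 2).
    rewrite (trigT_swap (@continuous_sin R) (@norm_sin_le1 R) isi iu).
    by apply: eq_Rintegral => x _; rewrite expr2.
  apply: (eq_trans _ (f_equal2 (fun y z => y + z) E1 E2)).
  apply: (eq_trans _ (RintegralD measurableT (schwartz_mul_L1 Su Scc) (schwartz_mul_L1 Su Sss))).
  by apply: eq_Rintegral => x _; rewrite mulrC /A mulrDr.
(* After expanding the square, [P2] and [P3] turn everything into multiples of the integral of u^2,
   with coefficients (2 pi)^2 - 4 pi (2 pi) + (2 pi)^2 = 0. *)
transitivity (\I (fun x => (A x ^+ 2 + B x ^+ 2) + ((- (4 * pi)) * (A x * u x) +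
   (2 * pi) ^+ 2 * u x ^+ 2))).
  by apply: eq_Rintegral => x _; rewrite -/(A x) -/(B x); ring.
have iAu := schwartz_mul_L1 SA Su.
rewrite RintegralD//; last 2 first.
- by apply: L1D; exact: I2.
- by apply: L1D; apply: L1Z => //; exact: I2.
rewrite P2 RintegralD//; last 2 first.
- exact: L1Z.
- by apply: L1Z; exact: I2.
rewrite (RintegralZl _ measurableT iAu) (RintegralZl _ measurableT (I2 _ Su)) P3.
by ring.
Qed.

(** The vanishing integral of [fourier_inversion_L2] gives A = 2 pi u and B = 0 almost everywhere,
    so the integrands agree almost everywhere for any measurable weight. *)
Lemma weighted_inversion (w : R -> R) u : measurable_fun setT w -> S u ->
  (forall v, S v -> L1 (fun x => w x * v x ^+ 2)) ->
  \I (fun x => w x * (cosT (cosT u) x + sinT (sinT u) x) ^+ 2) +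
  \I (fun x => w x * (cosT (sinT u) x - sinT (cosT u) x) ^+ 2) =
  (2 * pi) ^+ 2 * \I (fun x => w x * u x ^+ 2).
Proof.
move=> mw Su Lw; have z := fourier_inversion_L2 Su.
have [Sc Ss] := schwartz_trigT Su.
have [Scc Ssc] := schwartz_trigT Sc; have [Scs Sss] := schwartz_trigT Ss.
pose A x := cosT (cosT u) x + sinT (sinT u) x.
pose B x := cosT (sinT u) x - sinT (cosT u) x.
have SA : S A by exact: schwartzD.
have SB : S B by exact: schwartzB.
have SD : S (fun x => A x - 2 * pi * u x) by apply: schwartzB => //; exact: schwartzZ.
rewrite -RintegralD//; [|exact: (Lw A)|exact: (Lw B)].
rewrite -RintegralZl//; last exact: Lw.
rewrite /Rintegral; congr fine.
have i2 : L1 (fun x => (A x - 2 * pi * u x) ^+ 2 + B x ^+ 2).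
  by apply: L1_ext (L1D (schwartz_mul_L1 SD SD) (schwartz_mul_L1 SB SB)) => x; rewrite !expr2.
have mE v : L1 v -> measurable_fun setT (fun x => (v x)%:E) by move=> /L1_measurable /measurable_EFinP.
apply: ae_eq_integral => //.
- by apply: mE; apply: L1D; [exact: (Lw A)|exact: (Lw B)].
- by apply: mE; apply: L1Z; exact: Lw.
have h : (\int[mu]_x `|((A x - 2 * pi * u x) ^+ 2 + B x ^+ 2)%:E| = 0)%E.
  under eq_integral do rewrite gee0_abs ?lee_fin ?addr_ge0 ?sqr_ge0//.
  by rewrite -EFin_int// z.
have := (ae_eq_integral_abs mu measurableT (mE _ i2)).1 h.
apply: filterS => x /= /(_ I) [] /eqP.
rewrite paddr_eq0 ?sqr_ge0// !sqrf_eq0 subr_eq0 => /andP[/eqP eA /eqP eB] _.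
apply: (f_equal EFin); rewrite -/(A x) -/(B x) eA eB; ring.
Qed.

End bump.

(** * Band-limited functions *)

Section paley.
Variable R : realType.
Implicit Types (u v : R -> R).

Lemma continuous_dilation (k : R -> R) (t : R) : continuous k -> continuous (fun x : R => k (x * t)).
Proof. by move=> ck x; apply: continuous_comp; [exact: mulrr_continuous|exact: ck]. Qed.

Lemma MVT_bound (f f' : R -> R) (K x : R) : (forall t : R, is_derive t 1 f (f' t)) ->
  (forall t, `|t| <= `|x| -> `|f' t| <= K) -> `|f x - f 0| <= K * `|x|.
Proof.
move=> df bf.
have cf : continuous f := is_derive_continuous df.
have [x0|/ltW x0] := leP 0 x.
  have [t] := MVT_segment x0 (fun t _ => df t) (continuous_subspaceT cf).
  rewrite in_itv/= => /andP[t0 tx] ->.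
  by rewrite subr0 normrM ler_wpM2r// bf// !ger0_norm.
have [t] := MVT_segment x0 (fun t _ => df t) (continuous_subspaceT cf).
rewrite in_itv/= => /andP[xt t0] E.
by rewrite distrC E sub0r normrM normrN ler_wpM2r// bf// !ler0_norm// lerN2.
Qed.

Lemma norm_cosB1_le (x : R) : `|cos x - 1| <= `|x|.
Proof.
rewrite -cos0 -[leRHS]mul1r; apply: (@MVT_bound _ (fun t => - sin t)) => t _.
by rewrite normrN norm_sin_le1.
Qed.

Lemma norm_sin_le_norm (x : R) : `|sin x| <= `|x|.
Proof.
rewrite -[sin x]subr0 -sin0 -[leRHS]mul1r; apply: (@MVT_bound _ cos) => t _.
exact: norm_cos_le1.
Qed.

Lemma norm_cosB1_le_sqr (x : R) : `|cos x - 1| <= x ^+ 2.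
Proof.
rewrite -cos0 -real_normK ?num_real// expr2; apply: (@MVT_bound _ (fun t => - sin t)) => t tx.
by rewrite normrN (le_trans (norm_sin_le_norm t)).
Qed.

Lemma norm_sinB_le_sqr (x : R) : `|sin x - x| <= x ^+ 2.
Proof.
rewrite -real_normK ?num_real// expr2 -[sin x - x]subr0 -[X in _ - X](subrr (0 : R)) -[X in _ - (X - _)]sin0.
apply: (@MVT_bound (fun x => sin x - x) (fun t => cos t - 1)) => t tx.
by rewrite (le_trans (norm_cosB1_le t)).
Qed.

Lemma norm_expRB1_le (x : R) : `|expR x - 1| <= expR `|x| * `|x|.
Proof.
rewrite -expR0; apply: (@MVT_bound _ expR) => t tx.
by rewrite ger0_norm ?expR_ge0// ler_expR (le_trans _ tx)// ler_norm.
Qed.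

Lemma norm_expRB1B_le (x : R) : `|expR x - 1 - x| <= expR `|x| * x ^+ 2.
Proof.
rewrite -[x ^+ 2]real_normK ?num_real// expr2 mulrA.
have -> : expR x - 1 - x = (expR x - x) - (expR 0 - 0) by rewrite expR0; ring.
apply: (@MVT_bound (fun x => expR x - x) (fun t => expR t - 1)) => t tx.
by apply: (le_trans (norm_expRB1_le t)); rewrite ler_pM ?expR_ge0// ler_expR.
Qed.

(** With zeta = al + i be, this bounds the real part of e^(i zeta) - 1 - i zeta, and the next lemma
    its imaginary part. *)
Lemma cos_expR_remainder (q al be : R) : `|be| <= q ->
  `|expR (- be) * cos al - 1 + be| <= expR q * (al ^+ 2 + be ^+ 2).
Proof.
move=> bq.
have e1 : expR (- be) <= expR q by rewrite ler_expR (le_trans _ bq)// -normrN ler_norm.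
have -> : expR (- be) * cos al - 1 + be = expR (- be) * (cos al - 1) + (expR (- be) - 1 - - be) by ring.
rewrite [leRHS]mulrDr (le_trans (ler_normD _ _))// lerD//.
  by rewrite normrM ler_pM// ?norm_cosB1_le_sqr// ger0_norm ?expR_ge0.
apply: (le_trans (norm_expRB1B_le (- be))); rewrite normrN sqrrN.
by rewrite ler_wpM2r ?sqr_ge0// ler_expR.
Qed.

Lemma sin_expR_remainder (q al be : R) : `|be| <= q ->
  `|expR (- be) * sin al - al| <= 2 * expR q * (al ^+ 2 + be ^+ 2).
Proof.
move=> bq.
have e1 : expR (- be) <= expR q by rewrite ler_expR (le_trans _ bq)// -normrN ler_norm.
have -> : expR (- be) * sin al - al = expR (- be) * (sin al - al) + al * (expR (- be) - 1) by ring.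
apply: (le_trans (ler_normD _ _)).
have h1 : `|expR (- be) * (sin al - al)| <= expR q * al ^+ 2.
  by rewrite normrM ler_pM// ?norm_sinB_le_sqr// ger0_norm ?expR_ge0.
have h2 : `|al * (expR (- be) - 1)| <= expR q * (`|al| * `|be|).
  rewrite normrM mulrCA ler_wpM2l//; apply: (le_trans (norm_expRB1_le (- be))).
  by rewrite normrN ler_wpM2r// ler_expR.
have h3 : `|al| * `|be| <= al ^+ 2 + be ^+ 2.
  rewrite -(real_normK (num_real al)) -(real_normK (num_real be)).
  have := sqr_ge0 (`|al| - `|be|); have := sqr_ge0 `|al|; have := sqr_ge0 `|be|; nra.
have eq0 := expR_ge0 q.
have := ler_wpM2l eq0 h3; have := mulr_ge0 eq0 (sqr_ge0 be).
by move: h1 h2; lra.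
Qed.

Lemma cabs_le_ReIm (z : Cx R) : cabs z <= `|Re z| + `|Im z|.
Proof.
rewrite -(ler_pXn2r (n := 2))// ?nnegrE ?cabs_ge0 ?addr_ge0//.
rewrite cabs_sqr -(real_normK (num_real (Re z))) -(real_normK (num_real (Im z))).
have := mulr_ge0 (normr_ge0 (Re z)) (normr_ge0 (Im z)); nra.
Qed.

Lemma ReD (u v : Cx R) : Re (u + v) = Re u + Re v. Proof. by case: u; case: v. Qed.
Lemma ImD (u v : Cx R) : Im (u + v) = Im u + Im v. Proof. by case: u; case: v. Qed.
Lemma ReM (u v : Cx R) : Re (u * v) = Re u * Re v - Im u * Im v.
Proof. by case: u; case: v. Qed.
Lemma ImM (u v : Cx R) : Im (u * v) = Re u * Im v + Im u * Re v.
Proof. by case: u => a b; case: v. Qed.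

(** Reduces complex differentiability to a quadratic remainder estimate on real moduli. *)
Lemma derivableC (F : Cx R -> Cx R) (z D : Cx R) (M : R) :
  (forall h, cabs h <= 1 -> cabs (F (h + z) - F z - h * D) <= M * cabs h ^+ 2) ->
  derivable F z 1.
Proof.
move=> H; apply/cvg_ex; exists D; apply/cvgrPdist_le => e e0.
(* A strictly positive bound, so that it can be divided by. *)
pose M' : Cx R := ((`|M| + 1)%:C)%C.
have M'0 : 0 < M' by rewrite ltcR ltr_wpDl.
near=> h.
have h0 : h != 0 by near: h; exact: nbhs_dnbhs_neq.
have h1 : `|h| < 1 by near: h; exact: dnbhs0_lt.
have h2 : `|h| < e / M' by near: h; apply: dnbhs0_lt; rewrite divr_gt0.
have nh0 : 0 < `|h| by rewrite normr_gt0.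
have key : `|F (h + z) - F z - h * D| <= M' * `|h| ^+ 2.
  have h1' : cabs h <= 1 by rewrite -lecR; exact: ltW.
  have := H h h1'; rewrite -lecR => /le_trans; apply.
  rewrite -rmorphXn -rmorphM lecR ler_wpM2r ?sqr_ge0//.
  by rewrite (le_trans (ler_norm _))// lerDl.
have -> : D - h^-1 *: (F (h *: 1 + z) - F z) = - (h^-1 * (F (h + z) - F z - h * D)).
  rewrite /GRing.scale/= mulr1; field; exact: h0.
rewrite normrN normrM normfV ler_pdivrMl//; apply: (le_trans key).
by rewrite expr2 mulrA mulrC ler_wpM2l// mulrC -ler_pdivlMr// ltW.
Unshelve. all: by end_near. Qed.

(** * Fourier-Laplace transform of a function supported in [0, a] *)

Section transform.
Variables (phi : R -> R) (a : R).
Hypotheses (a0 : 0 < a) (Sphi : S phi) (supp : forall xi, ~~ (0 <= xi <= a) -> phi xi = 0).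

Definition damped (y xi : R) : R := phi xi * expR (- (y * xi)).

(** This is (2 pi)^(-1/2) times the integral of phi(xi) e^(i z xi). The factor e^(-y xi), with y =
    Im z, is put into [damped], which leaves real cosine and sine transforms at Re z. On the real
    line it is the inverse Fourier transform of [phi]. *)
Definition paley (z : Cx R) : Cx R :=
  (fourier_cst R * cosT (damped (Im z)) (Re z) +i* (fourier_cst R * sinT (damped (Im z)) (Re z)))%C.

Lemma damped_continuous y : continuous (damped y).
Proof.
move=> x; apply: cvgM; first exact: schwartz_continuous.
apply: continuous_comp; last exact: continuous_expR.
by apply: cvgN; exact: mulrl_continuous.
Qed.

Lemma damped_le y xi : `|damped y xi| <= expR (`|y| * a) * `|phi xi|.
Proof.
have [/andP[x0 xa]|/supp E] := boolP (0 <= xi <= a); last first.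
  by rewrite /damped E mul0r normr0 mulr0.
rewrite /damped normrM mulrC ler_wpM2r// ger0_norm ?expR_ge0// ler_expR.
by rewrite (le_trans (ler_norm _))// normrN normrM ler_wpM2l// ger0_norm.
Qed.

Lemma damped_L1 y : L1 (damped y).
Proof.
apply: (L1_le _ (L1Z (expR (`|y| * a)) (L1_norm (schwartz_L1 Sphi)))); last exact: damped_le.
by apply: continuous_measurable_fun; exact: damped_continuous.
Qed.

Lemma Xdamped_L1 y : L1 (fun xi => xi * damped y xi).
Proof.
apply: (L1_le _ (L1Z a (L1_norm (damped_L1 y)))).
  apply: continuous_measurable_fun => x.
  by apply: cvgM; [exact: cvg_id|exact: damped_continuous].
move=> xi; have [/andP[x0 xa]|/supp E] := boolP (0 <= xi <= a).
  by rewrite normrM ler_wpM2r// ger0_norm.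
by rewrite /damped E !mul0r mulr0 normr0 mulr0.
Qed.

Lemma damped_shift y b xi : damped (b + y) xi = damped y xi * expR (- (b * xi)).
Proof. by rewrite /damped -mulrA -expRD; congr (_ * expR _); ring. Qed.

(** The integrand of the first-order remainder of [paley] for the increment al + i b; suitable X, Y
    among plus or minus cos(xi x), sin(xi x) give its real and imaginary parts. The 3 is 1 + 2 from
    the two exponential remainders, and a^2 and e^a come from |xi| <= a and |b xi| <= a on the
    support. *)
Lemma paley_remainder y b al (X Y : R -> R) xi : `|al| <= 1 -> `|b| <= 1 ->
  `|X xi| <= 1 -> `|Y xi| <= 1 ->
  `|damped y xi * (X xi * (expR (- (b * xi)) * cos (xi * al) - 1 + b * xi) +
      Y xi * (expR (- (b * xi)) * sin (xi * al) - xi * al))| <=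
   (3 * expR a * a ^+ 2 * (al ^+ 2 + b ^+ 2)) * `|damped y xi|.
Proof.
move=> al1 b1 X1 Y1.
have [/andP[x0 xa]|/supp E] := boolP (0 <= xi <= a); last first.
  by rewrite /damped E !mul0r normr0 mulr0.
rewrite normrM mulrC ler_wpM2r//.
have bxi : `|b * xi| <= a.
  by rewrite normrM (ger0_norm x0) (le_trans _ xa)// ler_piMl.
have h1 := cos_expR_remainder (xi * al) bxi.
have h2 := sin_expR_remainder (xi * al) bxi.
have sq : (xi * al) ^+ 2 + (b * xi) ^+ 2 <= a ^+ 2 * (al ^+ 2 + b ^+ 2).
  rewrite !exprMn [b ^+ 2 * _]mulrC -mulrDr ler_wpM2r ?addr_ge0 ?sqr_ge0//.
  by rewrite lerXn2r// nnegrE// ltW.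
apply: (le_trans (ler_normD _ _)).
have g1 : `|X xi * (expR (- (b * xi)) * cos (xi * al) - 1 + b * xi)| <=
   expR a * (a ^+ 2 * (al ^+ 2 + b ^+ 2)).
  rewrite normrM -[leRHS]mul1r ler_pM//; apply: (le_trans h1).
  by rewrite ler_wpM2l ?expR_ge0.
have g2 : `|Y xi * (expR (- (b * xi)) * sin (xi * al) - xi * al)| <=
   2 * expR a * (a ^+ 2 * (al ^+ 2 + b ^+ 2)).
  rewrite normrM -[leRHS]mul1r ler_pM//; apply: (le_trans h2).
  by rewrite ler_wpM2l ?mulr_ge0 ?expR_ge0.
by apply: (le_trans (lerD g1 g2)); rewrite le_eqVlt; apply/orP; left; apply/eqP; ring.
Qed.

Lemma paley_entire : entire paley.
Proof.
move=> z; pose x := Re z; pose y := Im z; pose c := fourier_cst R.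
pose Xd xi := xi * damped y xi.
(* The candidate derivative, the transform of i xi phi(xi). *)
pose D : Cx R := (- (c * sinT Xd x) +i* (c * cosT Xd x))%C.
pose N := \I (fun xi => `|damped y xi|).
have N0 : 0 <= N by apply: Rintegral_ge0.
have c0 : 0 <= c by exact/ltW/fourier_cst_gt0.
(* The leading 2 adds the equal bounds [hR] and [hI] on the real and imaginary parts of the
   remainder. *)
apply: (@derivableC _ _ D (2 * (c * (3 * expR a * a ^+ 2 * N)))) => h h1.
have al1 : `|Re h| <= 1 := le_trans (norm_Re_le h) h1.
have b1 : `|Im h| <= 1 := le_trans (norm_Im_le h) h1.
set al := Re h in al1 *; set b := Im h in b1 *.
have bnd (X Y : R -> R) (I : R) : (forall t, `|X t| <= 1) -> (forall t, `|Y t| <= 1) ->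
    continuous X -> continuous Y ->
    I = \I (fun xi => damped y xi * (X xi * (expR (- (b * xi)) * cos (xi * al) - 1 + b * xi) +
      Y xi * (expR (- (b * xi)) * sin (xi * al) - xi * al))) ->
    `|I| <= (3 * expR a * a ^+ 2 * N) * cabs h ^+ 2.
  move=> X1 Y1 cX cY ->; rewrite cabs_sqr -/al -/b.
  have iN := L1Z (3 * expR a * a ^+ 2 * (al ^+ 2 + b ^+ 2)) (L1_norm (damped_L1 y)).
  have -> : 3 * expR a * a ^+ 2 * N * (al ^+ 2 + b ^+ 2) =
     \I (fun xi => (3 * expR a * a ^+ 2 * (al ^+ 2 + b ^+ 2)) * `|damped y xi|).
    rewrite RintegralZl//; last exact: L1_norm (damped_L1 y).
    by rewrite -/N; ring.
  have le xi := @paley_remainder y b al X Y xi al1 b1 (X1 xi) (Y1 xi).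
  apply: norm_int_le => //.
  apply: (L1_le _ iN le).
  apply: continuous_measurable_fun => t.
  have ce : continuous (fun xi => expR (- (b * xi))).
    move=> u; apply: continuous_comp; last exact: continuous_expR.
    by apply: cvgN; exact: mulrl_continuous.
  have ca : continuous (fun xi : R => xi * al) by exact: mulrr_continuous.
  have ccos : continuous (fun xi : R => cos (xi * al)).
    exact: (continuous_dilation (@continuous_cos R)).
  have csin : continuous (fun xi : R => sin (xi * al)).
    exact: (continuous_dilation (@continuous_sin R)).
  apply: cvgM; first exact: damped_continuous.
  apply: cvgD; apply: cvgM; [exact: cX| |exact: cY|].
    apply: cvgD; last exact: mulrl_continuous.
    apply: cvgB; last exact: cvg_cst.
    apply: cvgM; first exact: ce.
    exact: ccos.
  apply: cvgB; last exact: ca.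
  apply: cvgM; first exact: ce.
  exact: csin.
have cosx : continuous (fun xi : R => cos (xi * x)).
  exact: (continuous_dilation (@continuous_cos R)).
have sinx : continuous (fun xi : R => sin (xi * x)).
  exact: (continuous_dilation (@continuous_sin R)).
have dy := damped_L1 y; have dby := damped_L1 (b + y); have dX := Xdamped_L1 y.
have hR : `|Re (paley (h + z) - paley z - h * D)| <= c * ((3 * expR a * a ^+ 2 * N) * cabs h ^+ 2).
  pose I := cosT (damped (b + y)) (al + x) - cosT (damped y) x + (al * sinT Xd x + b * cosT Xd x).
  have -> : Re (paley (h + z) - paley z - h * D) = c * I.
    rewrite (ReB (paley (h + z) - paley z)) (ReB (paley (h + z))) (ReM h).
    transitivity (c * cosT (damped (Im (h + z))) (Re (h + z)) - c * cosT (damped y) x -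
      (Re h * Re D - Im h * Im D)); first by [].
    by rewrite ReD ImD /I /=; ring.
  rewrite normrM ger0_norm// ler_wpM2l//.
  apply: (bnd (fun xi => cos (xi * x)) (fun xi => - sin (xi * x))) => //.
  - by move=> t; exact: norm_cos_le1.
  - by move=> t; rewrite normrN norm_sin_le1.
  - by move=> t; apply: cvgN; exact: sinx.
  rewrite /I /trigT.
  have i1 := L1_trig cc c1 (al + x) dby; have i2 := L1_trig cc c1 x dy.
  have i3 := L1Z al (L1_trig cs s1 x dX); have i4 := L1Z b (L1_trig cc c1 x dX).
  rewrite -RintegralZl//; last exact: (L1_trig cs s1 x dX).
  rewrite -RintegralZl//; last exact: (L1_trig cc c1 x dX).
  rewrite -RintegralB// -RintegralD// -RintegralD//; last 2 first.
  - exact: L1B.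
  - exact: L1D.
  apply: eq_Rintegral => xi _; rewrite damped_shift mulrDr cosD /Xd; ring.
have hI : `|Im (paley (h + z) - paley z - h * D)| <= c * ((3 * expR a * a ^+ 2 * N) * cabs h ^+ 2).
  pose I := sinT (damped (b + y)) (al + x) - sinT (damped y) x + (b * sinT Xd x - al * cosT Xd x).
  have -> : Im (paley (h + z) - paley z - h * D) = c * I.
    rewrite (ImB (paley (h + z) - paley z)) (ImB (paley (h + z))) (ImM h).
    transitivity (c * sinT (damped (Im (h + z))) (Re (h + z)) - c * sinT (damped y) x -
      (Re h * Im D + Im h * Re D)); first by [].
    by rewrite ReD ImD /I /=; ring.
  rewrite normrM ger0_norm// ler_wpM2l//.
  apply: (bnd (fun xi => sin (xi * x)) (fun xi => cos (xi * x))) => //.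
  - by move=> t; exact: norm_sin_le1.
  - by move=> t; exact: norm_cos_le1.
  rewrite /I /trigT.
  have i1 := L1_trig cs s1 (al + x) dby; have i2 := L1_trig cs s1 x dy.
  have i3 := L1Z b (L1_trig cs s1 x dX); have i4 := L1Z al (L1_trig cc c1 x dX).
  rewrite -RintegralZl//; last exact: (L1_trig cs s1 x dX).
  rewrite -RintegralZl//; last exact: (L1_trig cc c1 x dX).
  rewrite -RintegralB// -RintegralB// -RintegralD//; last 2 first.
  - exact: L1B.
  - exact: L1B.
  apply: eq_Rintegral => xi _; rewrite damped_shift mulrDr sinD /Xd; ring.
apply: (le_trans (cabs_le_ReIm _)); apply: (le_trans (lerD hR hI)).
by rewrite le_eqVlt; apply/orP; left; apply/eqP; ring.
Qed.

(** On the support 0 <= xi <= a, hence |e^(i z xi)| = e^(-y xi) <= e^(a |z|) with y = Im z. *)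
Lemma paley_exp_type : exp_type a paley.
Proof.
split; first exact: paley_entire.
move=> e e0; have c0 := fourier_cst_gt0 R.
pose M := \I (fun xi => `|phi xi|).
have M0 : 0 <= M by apply: Rintegral_ge0.
(* The 2 accounts for real and imaginary parts; the 1 keeps the constant positive when [phi]
   vanishes. *)
exists (2 * (fourier_cst R * M) + 1); split.
  by rewrite ltr_wpDl// !mulr_ge0// ltW.
move=> z; pose y := Im z.
have iphi := L1_norm (schwartz_L1 Sphi).
have bnd : \I (fun xi => `|damped y xi|) <= expR ((a + e) * cabs z) * M.
  rewrite -RintegralZl//; apply: le_Rintegral => //.
  - exact: L1_norm (damped_L1 y).
  - exact: L1Z.
  move=> xi _; apply: (le_trans (damped_le y xi)); rewrite ler_wpM2r// ler_expR mulrC.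
  have zy := norm_Im_le z; have z0 := cabs_ge0 z.
  by apply: ler_pM => //; [exact: ltW|rewrite lerDl ltW].
have step k : (continuous k) -> (forall t, `|k t| <= 1) ->
   `|fourier_cst R * trigT k (damped y) (Re z)| <= fourier_cst R * M * expR ((a + e) * cabs z).
  move=> ck k1; rewrite normrM ger0_norm ?(ltW c0)// -mulrA ler_wpM2l ?(ltW c0)// mulrC.
  exact: le_trans (trigT_bound ck k1 _ (damped_L1 y)) bnd.
apply: (le_trans (cabs_le_ReIm _)).
apply: (@le_trans _ _ (2 * (fourier_cst R * M) * expR ((a + e) * cabs z))).
  have := lerD (step _ cc c1) (step _ cs s1); rewrite /paley /=.
  by move=> /le_trans; apply; rewrite le_eqVlt; apply/orP; left; apply/eqP; ring.
by rewrite ler_wpM2r ?expR_ge0// lerDl.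
Qed.

Lemma Re_on_real_paley (x : R) : Re (on_real paley x) = fourier_cst R * cosT phi x.
Proof.
rewrite /on_real /paley /=; congr (_ * _); apply: eq_Rintegral => xi _.
by rewrite /damped mul0r oppr0 expR0 mulr1.
Qed.

Lemma Im_on_real_paley (x : R) : Im (on_real paley x) = fourier_cst R * sinT phi x.
Proof.
rewrite /on_real /paley /=; congr (_ * _); apply: eq_Rintegral => xi _.
by rewrite /damped mul0r oppr0 expR0 mulr1.
Qed.

Lemma schwartz_on_real_paley : schwartz (on_real paley).
Proof.
have [Sc Ss] := schwartz_trigT Sphi; split.
  rewrite (_ : (fun x => _) = (fun x => fourier_cst R * cosT phi x)); first exact: schwartzZ.
  by apply/funext => x; exact: Re_on_real_paley.
rewrite (_ : (fun x => _) = (fun x => fourier_cst R * sinT phi x)); first exact: schwartzZ.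
by apply/funext => x; exact: Im_on_real_paley.
Qed.

End transform.

(** If |f| <= K then |f|^p <= K^(p-2) |f|^2, which is integrable. *)
Lemma schwartz_in_Lp (p : R) (f : R -> Cx R) : 2 <= p -> schwartz f -> in_Lp p f.
Proof.
move=> p2 [Sr Si].
have mr := L1_measurable (schwartz_L1 Sr); have mi := L1_measurable (schwartz_L1 Si).
split; first by split.
have [M hM] := schwartz_bounded Sr; have [N hN] := schwartz_bounded Si.
have bf x : cabs (f x) <= M + N by apply: (le_trans (cabs_le_ReIm _)); rewrite lerD.
have MN0 : 0 <= M + N := le_trans (cabs_ge0 _) (bf 0).
rewrite /cLnorm unlock; apply: poweR_lty.
have i2 : L1 (fun x => (M + N) `^ (p - 2) * (Re (f x) * Re (f x) + Im (f x) * Im (f x))).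
  by apply: L1Z; apply: L1D; exact: schwartz_mul_L1.
have mc : measurable_fun setT (fun x => cabs (f x)).
  have -> : (fun x => cabs (f x)) = (fun x => Num.sqrt (Re (f x) ^+ 2 + Im (f x) ^+ 2)).
    by apply/funext => x; rewrite -cabs_sqr sqrtr_sqr ger0_norm// cabs_ge0.
  apply: measurableT_comp; first exact: continuous_measurable_fun (@sqrt_continuous R).
  by apply: measurable_funD; exact: measurable_funX.
apply: (@le_lt_trans _ _ (\int[mu]_x ((M + N) `^ (p - 2) * (Re (f x) * Re (f x) + Im (f x) * Im (f x)))%:E)%E); last first.
  by rewrite -EFin_int// ltry.
apply: ge0_le_integral => //.
- by move=> x _; exact: poweR_ge0.
- apply/measurable_EFinP; apply: (measurableT_comp (measurable_powR p)).
  exact: measurableT_comp.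
- exact: measurable_int i2.
- move=> x _ /=; rewrite lee_fin ger0_norm ?cabs_ge0//.
  have -> : Re (f x) * Re (f x) + Im (f x) * Im (f x) = cabs (f x) ^+ 2 by rewrite cabs_sqr.
  have [->|f0] := eqVneq (cabs (f x)) 0.
    rewrite powR0; first by rewrite expr0n mulr0.
    by rewrite gt_eqF// (lt_le_trans _ p2).
  rewrite -powR_mulrn ?cabs_ge0//.
  rewrite [in leLHS](_ : p = (p - 2) + 2); last by rewrite subrK.
  rewrite powRD; last by rewrite f0 implybT.
  rewrite ler_wpM2r ?powR_ge0// ge0_ler_powR ?subr_ge0 ?nnegrE ?cabs_ge0//.
Qed.

Lemma PW_paley (s a : R) (phi : R -> R) : 0 < s -> s < 2^-1 -> 0 < a -> S phi ->
  (forall xi, ~~ (0 <= xi <= a) -> phi xi = 0) -> PW s a (paley phi).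
Proof.
move=> s0 s2 a0 Sphi supp; split; first exact: paley_exp_type.
have Sf := schwartz_on_real_paley Sphi.
have s1' : s <= 1 by lra.
split; last exact: schwartz_fracLap_finite.
(* The exponent 2^* is at least 2, because 0 < 1/2 - s <= 1/2. *)
apply: schwartz_in_Lp => //; rewrite /star_exp -[leLHS]invrK lef_pV2 ?posrE ?subr_gt0 ?invr_gt0//.
by rewrite lerBlDr lerDl ltW.
Qed.

(** The restriction of [paley phi] to the real line has Fourier transform [phi] almost everywhere,
    by [weighted_inversion]; the norm is thus read directly on [phi]. *)
Lemma L2sqr_fracLap_paley (s : R) (phi : R -> R) : 0 < s -> s <= 1 -> S phi ->
  L2sqr (fracLap s (distr_of (on_real (paley phi)))) = (\I (fun xi => (xi ^+ 2) `^ s * phi xi ^+ 2))%:E.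
Proof.
move=> s0 s1' Sphi; have Sf := schwartz_on_real_paley Sphi.
rewrite (L2sqr_fracLap s0 s1' Sf); congr EFin.
have [Sc Ss] := schwartz_trigT Sphi.
have ic := schwartz_L1 Sc; have isn := schwartz_L1 Ss.
have eR : (fun x => Re (on_real (paley phi) x)) = (fun x => fourier_cst R * cosT phi x).
  by apply/funext => x; exact: Re_on_real_paley.
have eI : (fun x => Im (on_real (paley phi) x)) = (fun x => fourier_cst R * sinT phi x).
  by apply/funext => x; exact: Im_on_real_paley.
have eF xi : fourier_re (on_real (paley phi)) xi = fourier_cst R * (cosT (cosT phi) xi + sinT (sinT phi) xi).
  by rewrite /fourier_re eR eI (trigTZ cc c1)// (trigTZ cs s1)// mulrDr.
have eG xi : fourier_im (on_real (paley phi)) xi = fourier_cst R * (cosT (sinT phi) xi - sinT (cosT phi) xi).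
  by rewrite /fourier_im eR eI (trigTZ cc c1)// (trigTZ cs s1)// mulrBr.
have Lw v : S v -> L1 (fun x => (x ^+ 2) `^ s * v x ^+ 2) by exact: L1_powR_sqr.
have mw : measurable_fun setT (fun x : R => (x ^+ 2) `^ s).
  exact: continuous_measurable_fun (continuous_powR_sqr s0).
have h := weighted_inversion mw Sphi Lw.
have cc1 := fourier_cst_sqr R.
have [Scc Ssc] := schwartz_trigT Sc; have [Scs Sss] := schwartz_trigT Ss.
have E1 : \I (fun xi => (xi ^+ 2) `^ s * fourier_re (on_real (paley phi)) xi ^+ 2) =
    fourier_cst R ^+ 2 * \I (fun x => (x ^+ 2) `^ s * (cosT (cosT phi) x + sinT (sinT phi) x) ^+ 2).
  rewrite -RintegralZl//; last exact: (Lw (fun x => _ + _) (schwartzD Scc Sss)).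
  by apply: eq_Rintegral => x _; rewrite eF; ring.
have E2 : \I (fun xi => (xi ^+ 2) `^ s * fourier_im (on_real (paley phi)) xi ^+ 2) =
    fourier_cst R ^+ 2 * \I (fun x => (x ^+ 2) `^ s * (cosT (sinT phi) x - sinT (cosT phi) x) ^+ 2).
  rewrite -RintegralZl//; last exact: (Lw (fun x => _ - _) (schwartzB Scs Ssc)).
  by apply: eq_Rintegral => x _; rewrite eG; ring.
rewrite E1 E2 -mulrDr h.
(* One factor [fourier_cst R ^+ 2] comes from [paley], one from the transform, and (2 pi)^2 from the
   inversion. *)
transitivity ((fourier_cst R ^+ 2 * (2 * pi)) ^+ 2 * \I (fun x => (x ^+ 2) `^ s * phi x ^+ 2)).
  by ring.
by rewrite cc1 expr1n mul1r.
Qed.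

End paley.

(** * Translating the spectrum *)

Section shifted_bumps.
Variable R : realType.

Lemma int_bump_shift (p q t : R) (k : R -> R) : L1 (fun xi => bump p q xi * k (xi + t)) ->
  \I (fun xi => bump (p + t) (q + t) xi * k xi) = \I (fun xi => bump p q xi * k (xi + t)).
Proof.
move=> ik; have := int_affine (- t) (oner_neq0 R) ik.
rewrite normr1 invr1 mul1r => <-; apply: eq_Rintegral => xi _.
by rewrite mul1r subrK -[in LHS](subrK t xi) bump_shift subrK.
Qed.

(** With [sinT_bump_shift] this says that translating the bump rotates the pair of its cosine and
    sine transforms by the angle t x, that is, multiplies the function by e^(itx). *)
Lemma cosT_bump_shift (p q t x : R) : cosT (bump (p + t) (q + t)) x =
  cos (t * x) * cosT (bump p q) x - sin (t * x) * sinT (bump p q) x.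
Proof.
have ib := schwartz_L1 (schwartz_bump p q).
have ic := L1_trig (@continuous_cos R) (@norm_cos_le1 R) x ib.
have isn := L1_trig (@continuous_sin R) (@norm_sin_le1 R) x ib.
have E xi : bump p q xi * cos ((xi + t) * x) =
    cos (t * x) * (bump p q xi * cos (xi * x)) - sin (t * x) * (bump p q xi * sin (xi * x)).
  by rewrite mulrDl cosD; ring.
rewrite /trigT (@int_bump_shift p q t (fun xi => cos (xi * x))); last first.
  by apply: L1_ext (L1B (L1Z (cos (t * x)) ic) (L1Z (sin (t * x)) isn)) => xi; rewrite E.
under eq_Rintegral => xi _ do rewrite E.
rewrite RintegralB//; [|exact: L1Z..].
by rewrite !RintegralZl.
Qed.

Lemma sinT_bump_shift (p q t x : R) : sinT (bump (p + t) (q + t)) x =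
  sin (t * x) * cosT (bump p q) x + cos (t * x) * sinT (bump p q) x.
Proof.
have ib := schwartz_L1 (schwartz_bump p q).
have ic := L1_trig (@continuous_cos R) (@norm_cos_le1 R) x ib.
have isn := L1_trig (@continuous_sin R) (@norm_sin_le1 R) x ib.
have E xi : bump p q xi * sin ((xi + t) * x) =
    sin (t * x) * (bump p q xi * cos (xi * x)) + cos (t * x) * (bump p q xi * sin (xi * x)).
  by rewrite mulrDl sinD; ring.
rewrite /trigT (@int_bump_shift p q t (fun xi => sin (xi * x))); last first.
  by apply: L1_ext (L1D (L1Z (sin (t * x)) ic) (L1Z (cos (t * x)) isn)) => xi; rewrite E.
under eq_Rintegral => xi _ do rewrite E.
rewrite RintegralD//; [|exact: L1Z..].
by rewrite !RintegralZl.
Qed.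

Lemma cabs_paley_sqr (phi : R -> R) (x : R) : cabs (on_real (paley phi) x) ^+ 2 =
  fourier_cst R ^+ 2 * (cosT phi x ^+ 2 + sinT phi x ^+ 2).
Proof. by rewrite cabs_sqr Re_on_real_paley Im_on_real_paley !exprMn mulrDr. Qed.

Lemma cabs_paley_bump_shift (p q t x : R) :
  cabs (on_real (paley (bump (p + t) (q + t))) x) = cabs (on_real (paley (bump p q)) x).
Proof.
have cabs_sqrt (z : Cx R) : cabs z = Num.sqrt (cabs z ^+ 2).
  by rewrite sqrtr_sqr ger0_norm// cabs_ge0.
apply: (eq_trans (cabs_sqrt _)); apply: (eq_trans _ (esym (cabs_sqrt _))).
apply: (f_equal (@Num.sqrt R)); apply: (eq_trans (cabs_paley_sqr _ _)).
apply: (eq_trans _ (esym (cabs_paley_sqr _ _))).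
apply: (f_equal (fun y => fourier_cst R ^+ 2 * y)).
rewrite cosT_bump_shift sinT_bump_shift.
set C := cosT _ _; set D := sinT _ _.
transitivity ((cos (t * x) ^+ 2 + sin (t * x) ^+ 2) * (C ^+ 2 + D ^+ 2)); first by ring.
by rewrite cos2Dsin2 mul1r.
Qed.

Lemma deBranges_norm_bump_shift (E : Cx R -> Cx R) (p q t : R) :
  deBranges_norm E (paley (bump (p + t) (q + t))) = deBranges_norm E (paley (bump p q)).
Proof.
have cabsM (z w : Cx R) : cabs (z * w) = cabs z * cabs w by exact: ComplexField.Normc.normcM.
rewrite /deBranges_norm /cLnorm; apply: eq_Lnorm => x; apply: (f_equal EFin).
apply: (eq_trans (cabsM _ _)); apply: (eq_trans _ (esym (cabsM _ _))).
apply: (f_equal (fun y => y * _)); exact: cabs_paley_bump_shift.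
Qed.

Lemma ler_powR_sqr (s x y : R) : 0 < s -> 0 <= x -> x <= y -> (x ^+ 2) `^ s <= (y ^+ 2) `^ s.
Proof.
move=> s0 x0 xy; apply: (ge0_ler_powR (ltW s0)); rewrite ?nnegrE ?sqr_ge0//.
by rewrite lerXn2r ?nnegrE// (le_trans x0).
Qed.

Lemma ltr_powR_sqr (s x y : R) : 0 < s -> 0 <= x -> x < y -> (x ^+ 2) `^ s < (y ^+ 2) `^ s.
Proof.
move=> s0 x0 xy; apply: (gt0_ltr_powR s0); rewrite ?nnegrE ?sqr_ge0//.
by rewrite ltrXn2r.
Qed.

(** The two bumps have the same positive L^2 norm, and two constants separate the weights: at most
    q^(2s) on the first support, at least (p + t)^(2s) on the second. The gap q < p + t makes the
    inequality strict. *)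
Lemma weighted_bump_lt (s p q t : R) : 0 < s -> s <= 1 -> 0 <= p -> p < q -> q < p + t ->
  \I (fun xi => (xi ^+ 2) `^ s * bump p q xi ^+ 2) <
  \I (fun xi => (xi ^+ 2) `^ s * bump (p + t) (q + t) xi ^+ 2).
Proof.
move=> s0 s1 p0 pq qt.
have Sb (p' q' : R) : real_schwartz (bump p' q') by exact: schwartz_bump.
have i2 (p' q' : R) : L1 (fun xi => bump p' q' xi ^+ 2).
  by apply: (L1_ext _ (schwartz_mul_L1 (Sb p' q') (Sb p' q'))) => x; rewrite expr2.
have shiftE : \I (fun xi => bump (p + t) (q + t) xi ^+ 2) = \I (fun xi => bump p q xi ^+ 2).
  have := int_affine (- t) (oner_neq0 R) (i2 p q); rewrite normr1 invr1 mul1r => <-.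
  by apply: eq_Rintegral => xi _; rewrite mul1r -[in LHS](subrK t xi) bump_shift.
have q0 : 0 < q := le_lt_trans p0 pq.
have pt0 : 0 < p + t := lt_trans q0 qt.
apply: (@le_lt_trans _ _ ((q ^+ 2) `^ s * \I (fun xi => bump p q xi ^+ 2))).
  rewrite -(RintegralZl _ measurableT (i2 p q)).
  apply: (le_Rintegral measurableT (L1_powR_sqr s0 s1 (Sb _ _)) (L1Z _ (i2 p q))).
  move=> xi _; have [/andP[px xq]|/bump_eq0 ->] := boolP (p < xi < q); last by rewrite expr0n !mulr0.
  apply: ler_wpM2r; first exact: sqr_ge0.
  exact: ler_powR_sqr s0 (le_trans p0 (ltW px)) (ltW xq).
apply: (@lt_le_trans _ _ (((p + t) ^+ 2) `^ s * \I (fun xi => bump p q xi ^+ 2))).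
  rewrite (ltr_pM2r (int_bump_sqr_gt0 pq)).
  exact: ltr_powR_sqr s0 (ltW q0) qt.
rewrite -shiftE -(RintegralZl _ measurableT (i2 (p + t) (q + t))).
apply: (le_Rintegral measurableT (L1Z _ (i2 _ _)) (L1_powR_sqr s0 s1 (Sb _ _))).
move=> xi _; have [/andP[px xq]|/bump_eq0 ->] := boolP (p + t < xi < q + t); last by rewrite expr0n !mulr0.
apply: ler_wpM2r; first exact: sqr_ge0.
exact: ler_powR_sqr s0 (ltW pt0) (ltW px).
Qed.

End shifted_bumps.

Theorem theorem5p6 (R : realType) (a s : R)
    (ha : 0 < a) (hs0 : 0 < s) (hs1 : s < 2^-1) :
  ~ exists E : Cx R -> Cx R,
      [/\ hermite_biehler E,
          forall f : Cx R -> Cx R, PW s a f <-> deBranges E f &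
          forall f : Cx R -> Cx R, PW s a f ->
            PW_norm s f = deBranges_norm E f].
Proof.
move=> [E [_ _ normE]].
pose q := a / 4; pose t := a / 2.
have s1 : s <= 1 by lra.
have supp p' q' : 0 <= p' -> q' <= a -> forall xi, ~~ (0 <= xi <= a) -> bump p' q' xi = 0.
  move=> p0 qa xi; apply: contraNeq => h; have {h} : p' < xi < q'.
    by apply: contra_neqT h => /bump_eq0.
  by move=> /andP[px xq]; rewrite (le_trans p0 (ltW px)) (le_trans (ltW xq) qa).
have q_gt0 : 0 < q by rewrite divr_gt0.
have t_gt0 : 0 < t by rewrite divr_gt0.
have PW1 : PW s a (paley (bump 0 q)).
  apply: PW_paley => //; first exact: schwartz_bump.
  by apply: supp => //; rewrite /q; lra.
(* The endpoint is kept as [0 + t] so that the shift lemmas apply with p = 0. *)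
have PW2 : PW s a (paley (bump (0 + t) (q + t))).
  apply: PW_paley => //; first exact: schwartz_bump.
  by apply: supp; rewrite ?add0r ?(ltW t_gt0)// /q /t; lra.
have eqn : PW_norm s (paley (bump (0 + t) (q + t))) = PW_norm s (paley (bump 0 q)).
  apply: (eq_trans (normE _ PW2)); apply: (eq_trans _ (esym (normE _ PW1))).
  exact: deBranges_norm_bump_shift.
have qt : q < 0 + t by rewrite /q /t; lra.
have := weighted_bump_lt hs0 s1 (lexx 0) q_gt0 qt.
have Q1 := L2sqr_fracLap_paley hs0 s1 (schwartz_bump 0 q).
have Q2 := L2sqr_fracLap_paley hs0 s1 (schwartz_bump (0 + t) (q + t)).
(* Equality of norms is passed to squared norms, which are the explicit integrals given by [Q1] and
   [Q2]. *)
have eqn2 : L2sqr (fracLap s (distr_of (on_real (paley (bump (0 + t) (q + t)))))) =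
    L2sqr (fracLap s (distr_of (on_real (paley (bump 0 q))))).
  apply: (eq_trans (L2sqrE _)); apply: (eq_trans _ (esym (L2sqrE _))).
  by apply: (f_equal (fun y => (y `^ 2)%E)); exact: eqn.
have eqI := EFin_inj (eq_trans (eq_trans (esym Q2) eqn2) Q1).
by move=> /lt_eqF /eqP; apply; exact: esym eqI.
Qed.
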